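(* Let $k$ be a number field of signature $(r_1,r_2)$ with class number $h_k$ and absolute value of discriminant $d_k$. Then $$h_k\leq \frac{242\, d_k^{3/4}}{(1.64)^{r_1}}.$$
   Context: Signature $(r_1,r_2)$ means that $k$ has $r_1$ real places and $r_2$ complex places. *)

(* Defs.v *)
From HB Require Import structures.
From mathcomp Require Import all_boot all_order all_algebra all_field complex.
From mathcomp Require Import all_classical all_reals all_analysis.

Set Implicit Arguments.
Unset Strict Implicit.
Unset Printing Implicit Defensive.

Import Order.TTheory GRing.Theory Num.Theory.

Local Open Scope classical_set_scope.
Local Open Scope card_scope.
Local Open Scope ring_scope.

(* A number field is a finite extension k : fieldExtType rat of the rationals. *)

Definition ring_of_integers (k : fieldExtType rat) : set k :=
  [set x | integralOver (intr : int -> k) x].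

Arguments ring_of_integers k : clear implicits.
(* An archimedean place is represented by the absolute value x |-> `|s x| that
   an embedding s of k into the complex numbers induces; two embeddings induce
   the same absolute value exactly when they are equal or complex conjugate.   *)
Definition real_places (R : realType) (k : fieldExtType rat) : set (k -> R[i]) :=
  [set w | exists2 s : {rmorphism k -> R[i]},
     (forall x, s x \is Num.real) & w = (fun x => `|s x|)].

Arguments real_places R k : clear implicits.
Definition complex_places (R : realType) (k : fieldExtType rat) :
    set (k -> R[i]) :=
  [set w | exists2 s : {rmorphism k -> R[i]},
     ~ (forall x, s x \is Num.real) & w = (fun x => `|s x|)].

Arguments complex_places R k : clear implicits.
Definition has_signature (R : realType) (k : fieldExtType rat) (r1 r2 : nat) :=
  real_places R k #= `I_r1 /\ complex_places R k #= `I_r2.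

(* The matrix is that of y |-> x * y in a rational basis of k (row vectors). *)
Definition field_trace (k : fieldExtType rat) (x : k) : rat :=
  let b := vbasis {:k} in
  \tr (\matrix_(i < \dim {:k}, j < \dim {:k}) coord b j (x * b`_i)).

Definition integral_basis (k : fieldExtType rat) (b : (\dim {:k}).-tuple k) :=
  free b /\ ring_of_integers k = [set x | inIntSpan b x].

Definition basis_disc (k : fieldExtType rat) (b : (\dim {:k}).-tuple k) : rat :=
  \det (\matrix_(i < \dim {:k}, j < \dim {:k}) field_trace (b`_i * b`_j)).

(* The value does not depend on which integral basis xget picks; the default
   argument of xget is irrelevant since every number field has one.            *)
Definition abs_disc (k : fieldExtType rat) : rat :=
  `|basis_disc (xget (vbasis {:k}) [set b | integral_basis b])|.

(* I is nonzero, hence the first clause; closure under opposites comes from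
   multiplication by -1.                                                       *)
Definition fractional_ideal (k : fieldExtType rat) (I : set k) : Prop :=
  [/\ exists2 x, I x & x != 0,
      forall x y, I x -> I y -> I (x + y),
      forall a x, ring_of_integers k a -> I x -> I (a * x)
    & exists d, [/\ ring_of_integers k d, d != 0 &
                    forall x, I x -> ring_of_integers k (d * x)]].

(* The coset of I modulo the principal fractional ideals: the product of I with
   the principal ideal generated by a is [set a * x | x in I].                 *)
Definition ideal_class (k : fieldExtType rat) (I : set k) : set (set k) :=
  [set J | exists2 a : k, a != 0 & J = [set a * x | x in I]].

Definition class_group (k : fieldExtType rat) : set (set (set k)) :=
  [set ideal_class I | I in @fractional_ideal k].

Arguments class_group k : clear implicits.
(* The order of the class group as an extended real, +oo if it were infinite. *)
Definition class_number (R : realType) (k : fieldExtType rat) : \bar R :=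
  counting (class_group k).

(* Main.v *)
(* Minkowski's convex body argument, in a purely combinatorial form, with the
   cross-polytope {x : sum_sigma |Re sigma x + Im sigma x| <= t} shows that every
   ideal class contains a fractional ideal J containing the ring of integers O
   with [J : O] at most kappa = (3/2) 2^(r2) (n! / n^n) sqrt d_k.
   Writing J^-1 as a product of prime ideals, of which at most n lie above each
   prime number, turns J into an n-tuple of positive integers of product at most
   [J : O], and J is recovered from the tuple.  Hence h_k is at most the number
   of n-tuples of product at most kappa, itself at most kappa^(3/2) zeta(3/2)^n.
   This is a constant multiple of d_k^(3/4); the constant is controlled because
   8 zeta(3/2)^4 < e^6.  Finiteness of the set of the J above also yields, by
   the pigeonhole principle on the powers of an ideal, that fractional ideals
   are invertible. *)

Require Import Defs.
From HB Require Import structures.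
From mathcomp Require Import all_boot all_order all_algebra all_field complex.
From mathcomp Require Import all_classical all_reals all_analysis.
From mathcomp Require Import perm zify ring lra.

Set Implicit Arguments.
Unset Strict Implicit.
Unset Printing Implicit Defensive.

Import Order.TTheory GRing.Theory Num.Theory.
Import numFieldNormedType.Exports.

Local Open Scope classical_set_scope.
Local Open Scope ring_scope.

(** * Minkowski's theorem on linear forms *)

(** No quotient group is ever formed. An index is bounded below by exhibiting incongruent elements
    ([idx_ge]) and bounded above by refuting such a family with the pigeonhole principle for integer
    lattices, so finiteness always reads [~ idx_ge J O m]. The signature enters through the norm
    estimate: the passage to Re + Im costs a factor sqrt 2 for each nonreal embedding and nothing
    for a real one. After the power 3/2, every real place therefore saves 2^(3/4) > 1.64 against the
    worst case where all embeddings are nonreal. The exponent 3/2 itself is dictated by d^(3/4) =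
    (sqrt d)^(3/2). What remains is to bound (n! / n^n)^(3/2) (2^(3/4) zeta(3/2))^n uniformly in n,
    where n! / n^n decays like e^(-n) up to a factor of order sqrt n. The margin below e^6 is small,
    so this quantity grows for a while before it decreases, and its growth has to be followed
    numerically. *)

Lemma int_lattice_pigeonhole n (B : 'M[int]_n) (T : finType) (f : T -> 'rV[int]_n) :
  \det B != 0 -> (`|\det B| < #|T|)%N ->
  exists i j, i != j /\ exists z : 'rV_n, f i - f j = z *m B.
Proof.
have [L Lu [R Ru [d _ defB]]] := int_Smith_normal_form B.
set D := \matrix_(_, _) _ in defB => detB0 ltT.
have detU (M : 'M[int]_n) : M \in unitmx -> absz (\det M) = 1%N.
  move/mulmxV/(congr1 (absz \o determinant)) => /=.
  by rewrite det_mulmx det1 abszM => /eqP; rewrite muln_eq1 => /andP[/eqP].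
have detD : \det D = \prod_(i < n) d`_i.
  rewrite (_ : D = diag_mx (\row_j d`_j)) ?det_diag.
    by apply: eq_bigr => i _; rewrite mxE.
  apply/matrixP=> i j; rewrite !mxE -val_eqE /=.
  by case: eqVneq => [->|]; rewrite ?mulr1n ?mulr0n.
have detBD : absz (\det B) = absz (\det D).
  by rewrite defB !det_mulmx !abszM (detU L) ?(detU R) // mul1n muln1.
have dn0 (i : 'I_n) : d`_i != 0.
  have: \det D != 0 by rewrite -absz_eq0 -detBD absz_eq0.
  by rewrite detD => /prodf_neq0; apply.
have dgt0 (i : 'I_n) : (0 < absz (d`_i)%R)%N by rewrite absz_gt0.
have ltmod (i : 'I_n) (x : int) : (absz (x %% (d`_i)%R)%Z < absz (d`_i)%R)%N.
  by have := ltz_mod x (dn0 i); have := modz_ge0 x (dn0 i); lia.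
(* Since B = L D R with L and R unimodular, f i - f j lies in the row lattice of B as soon as [w i]
   and [w j] agree modulo every d_l. There are |det B| residue vectors. *)
pose w t := f t *m invmx R.
pose g t : {dffun forall i : 'I_n, 'I_(absz d`_i)} :=
  [ffun i => Ordinal (ltmod i (w t 0 i))].
have /injectivePn[i [j neq_ij eq_g]] : ~~ injectiveb g.
  apply/injectiveP => /leq_card; rewrite card_dep_ffun leqNgt.
  rewrite foldrE big_map big_enum /=.
  under eq_bigr do rewrite card_ord.
  suff -> : \prod_(i < n) absz d`_i = absz (\det B) by rewrite ltT.
  rewrite detBD detD; elim/big_rec2: _ => // i a b _ ->.
  by rewrite abszM.
exists i, j; split=> //.
have eqm (l : 'I_n) : (w i 0%R l = w j 0%R l %[mod (d`_l)%R])%Z.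
  have /ffunP/(_ l) := eq_g; rewrite !ffunE => /(congr1 val) /=.
  by have := modz_ge0 (w i 0 l) (dn0 l); have := modz_ge0 (w j 0 l) (dn0 l); lia.
pose z : 'rV[int]_n := \row_l (((w i - w j)%R 0%R l) %/ (d`_l)%R)%Z.
exists (z *m invmx L).
have zD : z *m D = w i - w j.
  apply/rowP=> l; rewrite mxE (bigD1 l) //= big1 => [|m neq_ml]; last first.
    by rewrite !mxE val_eqE (negPf neq_ml) mulr0.
  rewrite /z mxE [D l l]mxE eqxx mulr1n addr0 divzK //.
  by rewrite mxE [(- w j) 0 l]mxE -eqz_mod_dvd; apply/eqP/eqm.
by rewrite [in RHS]defB !mulmxA mulmxKV // zD /w -mulmxBl mulmxKV.
Qed.

Definition l1norm {K : numDomainType} n (u : 'rV[K]_n) : K := \sum_i `|u 0 i|.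

(* The volume 2^n / n! of the cross-polytope enters through the number of integer
   vectors with entries a_i or - a_i - 1, where the naturals a_i sum to at most m. *)
Lemma l1norm_int_pigeonhole n m (B : 'M[int]_n) :
  \det B != 0 -> (n`! * `|\det B| < (2 * m) ^ n)%N ->
  exists2 v : 'rV[int]_n, v != 0 & l1norm (v *m B) <= (2 * (m + n))%:R.
Proof.
move=> detB0 ltm.
pose S := [set t : n.-tuple 'I_m.+1 | (\sum_(i <- t) i <= m)%N]%SET.
pose T := ({ffun 'I_n -> bool} * {t : n.-tuple 'I_m.+1 | t \in S})%type.
(* Using - a - 1 rather than - a keeps the two sign ranges disjoint, so all 2^n sign choices count
   even at a = 0. The price is 1 per entry, hence m + n in the norm bound. *)
pose u (x : T) : 'rV[int]_n :=
  \row_i (if x.1 i then (tnth (val x.2) i : nat)%:Z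
          else - ((tnth (val x.2) i : nat).+1)%:Z).
have card_tuples : #|{: T}| = (2 ^ n * 'C(n + m, n))%N.
  rewrite card_prod card_ffun card_bool card_ord card_sig.
  rewrite -card_partial_ord_partitions; congr (_ * _)%N.
have ltT : (`|\det B| < #|{: T}|)%N.
  rewrite card_tuples -(ltn_pmul2l (fact_gt0 n)) (leq_trans ltm) //.
  rewrite mulnCA expnMn leq_mul2l expn_eq0 /= mulnC bin_ffact.
  have lef k : (k <= n)%N -> (m ^ k <= (k + m) ^_ k)%N.
    elim: k => // k IHk lekn; rewrite addSn ffactSS expnS leq_mul //; lia.
  exact: lef.
have inju : injective u.
  move=> [e [t tS]] [e' [t' tS']] /rowP equ.
  have eqi i : e i = e' i /\ tnth t i = tnth t' i.
    have := equ i; rewrite !mxE /=.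
    case: (e i) (e' i) => [] [] ? //; split => //; try apply: val_inj => /=; lia.
  have eqe : e = e' by apply/ffunP => i; case: (eqi i).
  have eqt : t = t' by apply: eq_from_tnth => i; case: (eqi i).
  rewrite {}eqe; congr (_, _); exact: val_inj.
have u_le x : l1norm (u x) <= (m + n)%:R.
  case: x => e [t tS]; rewrite /l1norm.
  apply: (@le_trans _ _ (\sum_(i < n) ((tnth t i : nat).+1)%:Z)).
    by apply: ler_sum => i _; rewrite mxE /=; case: (e i); lia.
  have := tS; rewrite inE big_tuple => les.
  rewrite -(raddf_sum Posz) /=; under eq_bigr do rewrite -addn1.
  by rewrite big_split /= sum1_card card_ord natz lez_nat leq_add2r.
have [x [y [neq_xy [v defv]]]] := int_lattice_pigeonhole u detB0 ltT.
exists v.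
  apply: contraNneq neq_xy => v0; apply/eqP/inju/eqP.
  by rewrite -subr_eq0 defv v0 mul0mx.
rewrite -defv; apply: (@le_trans _ _ (l1norm (u x) + l1norm (u y))).
  rewrite /l1norm -big_split ler_sum // => i _; rewrite !mxE /=; lia.
by have := u_le x; have := u_le y; rewrite !natz; lia.
Qed.

Lemma l1norm_ge0 (K : numDomainType) n (u : 'rV[K]_n) : 0 <= l1norm u.
Proof. by apply: sumr_ge0 => i _; apply: normr_ge0. Qed.

Lemma l1normD (K : numDomainType) n (u v : 'rV[K]_n) :
  l1norm (u + v) <= l1norm u + l1norm v.
Proof.
by rewrite /l1norm -big_split; apply: ler_sum => i _; rewrite mxE ler_normD.
Qed.

Lemma l1norm_mulmx (K : numDomainType) m n c (u : 'rV[K]_m) (X : 'M[K]_(m, n)) :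
  (forall i, \sum_j `|X i j| <= c) -> l1norm (u *m X) <= c * l1norm u.
Proof.
move=> leX; apply: (@le_trans _ _ (\sum_j \sum_i `|u 0 i| * `|X i j|)).
  apply: ler_sum => j _; rewrite mxE (le_trans (ler_norm_sum _ _ _)) //.
  by apply: ler_sum => i _; rewrite normrM.
rewrite exchange_big mulr_sumr /=; apply: ler_sum => i _.
by rewrite -mulr_sumr mulrC ler_wpM2r.
Qed.

Lemma cvg_det (R : realType) n (M : nat -> 'M[R]_n) (A : 'M[R]_n) :
  (forall i j, M k i j @[k --> \oo] --> A i j) ->
  \det (M k) @[k --> \oo] --> \det A.
Proof.
move=> cvM; rewrite /determinant.
apply: cvg_big => [|s _]; first exact: add_continuous.
apply: cvgM; first exact: cvg_cst.
by apply: cvg_big => [|i _]; [exact: mul_continuous | exact: cvM].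
Qed.

Lemma cvg_rounding (R : realType) (a : R) :
  harmonic k * (Num.floor (k.+1%:R * a))%:~R @[k --> \oo] --> a.
Proof.
have cvgl : a - harmonic k @[k --> \oo] --> a.
  rewrite -[X in _ --> X]subr0; apply: cvgB; first exact: cvg_cst.
  exact: cvg_harmonic.
apply: (@squeeze_cvgr _ _ _ _ (fun k => a - harmonic k) (fun=> a)) => //; last first.
  exact: cvg_cst.
near=> k; rewrite /harmonic; set x := k.+1%:R : R.
have x0 : 0 < x by rewrite /x ltr0n.
have /andP[lef ltf] := floor_itv (x * a).
rewrite intrD in ltf.
rewrite ![_^-1 * _]mulrC ler_pdivlMr // ler_pdivrMr // mulrBl mulVf ?gt_eqF //.
by apply/andP; split; lra.
Unshelve. all: by end_near.
Qed.

(* Round N A to an integer matrix and let N grow. *)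
Theorem minkowski_linear_forms (R : realType) n (A : 'M[R]_n) (t : R) :
  \det A != 0 -> 0 < t -> n`!%:R * `|\det A| < t ^+ n ->
  exists2 v : 'rV[int]_n, v != 0 & l1norm (map_mx intr v *m A) <= t.
Proof.
move=> detA t0 ltt.
pose C := \sum_i \sum_j `|invmx A i j|.
have C0 : 0 <= C by do 2![apply: sumr_ge0 => ? _]; apply: normr_ge0.
have leC (u : 'rV[R]_n) : l1norm u <= C * l1norm (u *m A).
  have uA : A \in unitmx by rewrite unitmxE unitfE.
  rewrite -{1}[u](mulmxK uA); apply: l1norm_mulmx => i.
  rewrite /C [leRHS](bigD1 i) //= lerDl; apply: sumr_ge0 => ? _.
  by apply: sumr_ge0 => ? _; apply: normr_ge0.
(* [K] adds up the losses at scale x = k + 1: n C t for rounding x A to integers, 2 n for the shift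
   by n in [l1norm_int_pigeonhole], and 2 for truncating to the integer [m]. It gives x t - K < 2
   m. *)
pose K := n%:R * C * t + 2 * n%:R + 2.
pose B k : 'M[int]_n := \matrix_(i, j) Num.floor (k.+1%:R * A i j).
pose M k : 'M[R]_n := harmonic k *: map_mx intr (B k).
have cvM i j : M k i j @[k --> \oo] --> A i j.
  under eq_cvg do rewrite !mxE.
  exact: cvg_rounding.
have cvgdet := cvg_det cvM.
have cvgt : t - K * harmonic k @[k --> \oo] --> t.
  rewrite -[X in _ --> X]subr0 -[X in _ - X](mulr0 K).
  apply: cvgB; first exact: cvg_cst.
  by apply: cvgMr; exact: cvg_harmonic.
have [k [detMk Kt ltk]] : exists k, [/\ \det (M k) != 0, 0 < t - K * harmonic k
    & n`!%:R * `|\det (M k)| < (t - K * harmonic k) ^+ n].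
  have cvgl : n`!%:R * `|\det (M k)| @[k --> \oo] --> n`!%:R * `|\det A|.
    by apply: cvgMr; apply: cvg_norm.
  have cvgr : (t - K * harmonic k) ^+ n @[k --> \oo] --> t ^+ n.
    by apply: (continuous_cvg _ (@exprn_continuous _ n _)).
  pose e := (n`!%:R * `|\det A| + t ^+ n) / 2.
  near \oo => k; exists k; split.
  - by near: k; apply: (cvgr_neq0 _ cvgdet).
  - by near: k; apply: (cvgr_gt _ cvgt).
  - apply: (@lt_trans _ _ e); near: k.
      by apply: (cvgr_lt _ cvgl); rewrite /e; lra.
    by apply: (cvgr_gt _ cvgr); rewrite /e; lra.
pose x : R := k.+1%:R.
have x0 : 0 < x by rewrite /x ltr0n.
have hE : harmonic k = x^-1 by [].
have detMB : \det (M k) = x ^- n * (\det (B k))%:~R.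
  by rewrite /M detZ hE exprVn det_map_mx.
rewrite {}hE in Kt ltk.
have Kx : K < x * t by rewrite -ltr_pdivrMl // mulrC -subr_gt0.
have nCx : n%:R * C < x.
  rewrite -(ltr_pM2r t0); apply: lt_trans Kx; rewrite /K.
  have : 0 <= n%:R :> R by []. lra.
pose m := Num.truncn ((x - n%:R * C) * t / 2 - n%:R).
have arg0 : 0 <= (x - n%:R * C) * t / 2 - n%:R by move: Kx; rewrite /K; lra.
have /andP[lem ltm] := Num.Theory.truncn_itv arg0; rewrite -/m in lem ltm.
have ltBm : (n`! * `|\det (B k)| < (2 * m) ^ n)%N.
  rewrite -(ltr_nat R) natrM natrX natr_absz intr_norm.
  have xn0 : 0 < x ^+ n by rewrite exprn_gt0.
  have -> : `|(\det (B k))%:~R| = x ^+ n * `|\det (M k)| :> R.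
    rewrite detMB normrM ger0_norm ?mulrA ?divff ?mul1r ?gt_eqF //.
    by rewrite invr_ge0 ltW.
  rewrite mulrCA; apply: (@lt_le_trans _ _ (x ^+ n * (t - K * x^-1) ^+ n)).
    by rewrite ltr_pM2l.
  rewrite -exprMn lerXn2r ?nnegrE ?ler0n ?mulr_ge0 ?ltW //.
  rewrite mulrBr mulrCA divff ?gt_eqF // mulr1 natrM.
  by move: ltm; rewrite -[m.+1%:R]natr1 /K; lra.
have detBk : \det (B k) != 0.
  by apply: contraNneq detMk => B0; rewrite detMB B0 mulr0.
have [v v0 lev] := l1norm_int_pigeonhole detBk ltBm; exists v => //.
pose V : 'rV[R]_n := map_mx intr v.
have levB : l1norm (V *m map_mx intr (B k)) <= (x - n%:R * C) * t.
  have -> : l1norm (V *m map_mx intr (B k)) = (l1norm (v *m B k))%:~R.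
    rewrite -map_mxM /l1norm rmorph_sum /=; apply: eq_bigr => i _.
    by rewrite mxE intr_norm.
  apply: (@le_trans _ _ (2 * (m + n))%:R).
    by rewrite -(ler_int R) in lev; rewrite (le_trans lev) // natz.
  rewrite natrM natrD; lra.
have lexV : x * l1norm (V *m A) <=
    l1norm (V *m map_mx intr (B k)) + n%:R * l1norm V.
  have -> : x * l1norm (V *m A) = l1norm (V *m (x *: A)).
    rewrite -scalemxAr /l1norm mulr_sumr; apply: eq_bigr => i _.
    by rewrite [in RHS]mxE normrM (gtr0_norm x0).
  rewrite -{1}[x *: A](subrK (map_mx intr (B k))) mulmxDr.
  apply: le_trans (l1normD _ _) _; rewrite [leRHS]addrC; apply: lerD => //.
  apply: l1norm_mulmx => i.
  apply: (@le_trans _ _ (\sum_(j < n) 1)); last by rewrite sumr_const card_ord.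
  apply: ler_sum => j _; rewrite !mxE.
  by have := floor_itv (x * A i j); rewrite -/x intrD ler_norml => /andP[]; lra.
have := leC V; have := l1norm_ge0 V; have := l1norm_ge0 (V *m A).
move: (l1norm V) (l1norm (V *m A)) lexV => p q lexV q0 p0 leC'.
have npq : n%:R * p <= n%:R * C * q by rewrite -mulrA ler_wpM2l.
rewrite -(@ler_pM2l _ (x - n%:R * C)) ?subr_gt0 //.
by rewrite mulrBl; lra.
Unshelve. all: by end_near.
Qed.

(** * Embeddings and discriminants *)

Section Embeddings.
Variables (C : numClosedFieldType) (k : fieldExtType rat).
Implicit Types (q : {poly rat}) (x y : k) (f : {rmorphism k -> C}).

Lemma rmorph_in_alg (D : numFieldType) (f : {rmorphism k -> D}) (a : rat) :
  f a%:A = ratr a.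
Proof. by rewrite alg_num_field fmorph_rat. Qed.

Lemma map_horner_in_alg f q x : f (map_poly (in_alg k) q).[x] = (map_poly ratr q).[f x].
Proof.
rewrite -horner_map -map_poly_comp; congr _.[_].
by apply: eq_map_poly => a /=; rewrite rmorph_in_alg.
Qed.

(** Each x is q(theta) for some chosen q and is sent to q(z). Two choices of q differ by a multiple
    of the minimal polynomial, which vanishes at z. *)
Lemma exists_embedding (theta : k) (p : {poly rat}) (z : C) :
  (<<1; theta>> = {:k})%VS -> minPoly 1 theta = map_poly (in_alg k) p ->
  root (map_poly ratr p) z -> exists f : {rmorphism k -> C}, f theta = z.
Proof.
move=> gen_theta defp /rootP pz0.
have rep x : exists q, (map_poly (in_alg k) q).[theta] == x.
  have /polyOver1P[q defq] := Fadjoin_polyOver 1 theta x.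
  by exists q; rewrite -defq Fadjoin_poly_eq // gen_theta memvf.
pose val x := (map_poly ratr (xchoose (rep x))).[z].
have eqval q q' : (map_poly (in_alg k) q).[theta] = (map_poly (in_alg k) q').[theta] ->
    (map_poly ratr q).[z] = (map_poly ratr q').[z].
  move=> eqq; apply/eqP; rewrite -subr_eq0 -hornerN -hornerD -rmorphB /=.
  have : p %| q - q'.
    rewrite -(dvdp_map (in_alg k)) -defp minPoly_dvdp //.
      by apply/polyOver1P; exists (q - q').
    by rewrite /root rmorphB /= hornerD hornerN eqq subrr.
  by case/dvdpP=> u ->; rewrite rmorphM hornerM pz0 mulr0.
have valE q : val (map_poly (in_alg k) q).[theta] = (map_poly ratr q).[z].
  by apply: eqval; apply/eqP; rewrite (xchooseP (rep _)).
have valB : {morph val : x y / x - y}.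
  move=> x y; have [[q /eqP <-] [q' /eqP <-]] := (rep x, rep y).
  by rewrite -hornerN -hornerD -rmorphB !valE rmorphB hornerD hornerN.
have valM : monoid_morphism val.
  split=> [|x y].
    have {1}-> : 1 = (map_poly (in_alg k) 1).[theta] by rewrite rmorph1 hornerC.
    by rewrite valE rmorph1 hornerC.
  have [[q /eqP <-] [q' /eqP <-]] := (rep x, rep y).
  by rewrite -hornerM -rmorphM !valE rmorphM hornerM.
pose f : {rmorphism k -> C} := HB.pack val
  (GRing.isZmodMorphism.Build k C val valB) (GRing.isMonoidMorphism.Build k C val valM).
exists f; have {1}-> : theta = (map_poly (in_alg k) 'X).[theta] by rewrite map_polyX hornerX.
by rewrite /= valE map_polyX hornerX.
Qed.

(** The embeddings correspond to the roots of the minimal polynomial of a primitive element,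
    distinct by separability. The element [theta] stays in the statement because its distinct
    conjugates feed a Vandermonde determinant and separate embeddings later. *)
Lemma complete_embeddings :
  exists (theta : k) (s : 'I_(\dim {:k}) -> {rmorphism k -> C}),
  injective (fun i => s i theta) /\
  forall f : {rmorphism k -> C}, exists i, f =1 s i.
Proof.
have sep1 : separable 1%AS {:k}%AS.
  apply/separableP => x _; apply: pcharf0_separable; exact: ftrans (pchar_lalg k) (pchar_num _).
pose theta := separable_generator 1%AS {:k}%AS.
have gen_theta : <<1; theta>>%VS = {:k}%VS.
  by rewrite [RHS](eq_adjoin_separable_generator sep1) ?sub1v.
have /polyOver1P[p defp] := minPolyOver 1 theta.
have szp : size p = (\dim {:k}).+1.
  rewrite -(size_map_poly (in_alg k)) -defp size_minPoly adjoin_degreeE.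
  by rewrite gen_theta dimv1 divn1.
have monp : p \is monic by rewrite -(map_monic (in_alg k)) -defp monic_minPoly.
pose pC := map_poly (ratr : rat -> C) p.
have [rs defpC] := closed_field_poly_normal pC.
have lc1 : lead_coef pC = 1 by apply/eqP; rewrite -monicE map_monic.
rewrite {}lc1 scale1r in defpC.
have szrs : size rs = \dim {:k}.
  by apply: succn_inj; rewrite -szp -(size_prod_XsubC rs id) -defpC;
    rewrite -(size_map_poly (ratr : {rmorphism rat -> C})).
have urs : uniq rs.
  rewrite -separable_prod_XsubC -defpC separable_map.
  rewrite -(separable_map (in_alg k)) -defp.
  exact: (separable_generatorP {:k}%AS 1%AS).
have rootE z : root pC z = (z \in rs) by rewrite defpC root_prod_XsubC.
have ex_s (i : 'I_(\dim {:k})) : exists f : {rmorphism k -> C}, f theta = rs`_i.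
  by apply: exists_embedding gen_theta defp _; rewrite -/pC rootE mem_nth ?szrs.
have [s sE] : exists s : 'I_(\dim {:k}) -> {rmorphism k -> C}, forall i, s i theta = rs`_i.
  exact: (fin_all_exists ex_s).
exists theta, s; split.
  by move=> i j; rewrite !sE => /eqP; rewrite nth_uniq ?szrs // => /eqP/val_inj.
move=> f; have /(nthP 0)[m] : f theta \in rs.
  rewrite -rootE /root -map_horner_in_alg -defp.
  by rewrite (rootP (root_minPoly _ _)) rmorph0.
rewrite szrs => lti fi; exists (Ordinal lti) => x.
have /polyOver1P[q defq] := Fadjoin_polyOver 1 theta x.
have <- : (Fadjoin_poly 1 theta x).[theta] = x by rewrite Fadjoin_poly_eq // gen_theta memvf.
by rewrite defq !map_horner_in_alg sE -fi.
Qed.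
End Embeddings.

Lemma integral_ratr_int (C : numClosedFieldType) (q : rat) :
  integralOver (intr : int -> C) (ratr q) -> q \is a Num.int.
Proof.
case=> p monp pq0.
have {pq0} pq0 : root (map_poly (intr : int -> rat) p) q.
  rewrite -(fmorph_root (ratr : {rmorphism rat -> C})) -map_poly_comp.
  by rewrite (eq_map_poly (fun a => ratr_int C a)).
have : (ratr q : algC) \in Num.int.
  apply: Cint_rat_Aint; first exact: Crat_rat.
  apply: (@root_monic_Aint (map_poly intr p)).
  - rewrite -(eq_map_poly (fun a => ratr_int algC a)) map_poly_comp.
    by rewrite fmorph_root.
  - by rewrite monic_map.
  - by apply/polyOverP => i; rewrite coef_map /= intr_int.
move=> /intrP[m /eqP]; rewrite -(ratr_int algC) (inj_eq (fmorph_inj _)) => /eqP ->.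
exact: intr_int.
Qed.

Lemma integral_rmorphism (F L : nzRingType) (f : {rmorphism F -> L}) x :
  integralOver (intr : int -> F) x -> integralOver (intr : int -> L) (f x).
Proof.
move=> /(integral_rmorph f)[p monp rootp]; exists p => //.
by rewrite -(@eq_map_poly _ _ (f \o intr)) // => a; rewrite /= rmorph_int.
Qed.

Section EmbeddingMatrix.
Variables (C : numClosedFieldType) (k : fieldExtType rat).
Local Notation n := (\dim {:k}).
Variables (s : 'I_n -> {rmorphism k -> C}) (theta : k).
Hypothesis s_inj : injective (fun i => s i theta).
Implicit Types c : n.-tuple k.

Definition embmx c : 'M[C]_n := \matrix_(i, j) s j c`_i.

Lemma free_basis c : free c -> basis_of {:k} c.
Proof. by move=> fc; rewrite basisEfree fc subvf size_tuple leqnn. Qed.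

Lemma free_coord c x : free c -> x = \sum_i coord c i x *: c`_i.
Proof. by move=> fc; apply: coord_basis (free_basis fc) (memvf x). Qed.

Lemma embmx_mul (T : 'M[rat]_n) c c' :
  (forall i : 'I_n, c'`_i = \sum_j T i j *: c`_j) ->
  embmx c' = map_mx ratr T *m embmx c.
Proof.
move=> defc'; apply/matrixP=> i j; rewrite !mxE defc' rmorph_sum /=.
by apply: eq_bigr => l _; rewrite rmorphZ_num !mxE.
Qed.

Lemma embmx_scale (c c' : n.-tuple k) x :
  (forall i : 'I_n, c'`_i = x * c`_i) ->
  embmx c' = embmx c *m diag_mx (\row_j s j x).
Proof.
move=> defc'; apply/matrixP=> i j; rewrite mul_mx_diag !mxE defc' rmorphM.
exact: mulrC.
Qed.

(** The powers of [theta] are combinations of [c], so a zero determinant would annihilate the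
    Vandermonde determinant of the conjugates of [theta]. *)
Lemma det_embmx_neq0 c : free c -> \det (embmx c) != 0.
Proof.
move=> fc; pose d : n.-tuple k := [tuple theta ^+ i | i < n].
have defd := @embmx_mul (\matrix_(i, j) coord c j (theta ^+ i)) c d.
have {}defd := defd (fun i => _); apply: contraTneq isT => c0.
have : \det (embmx d) = 0.
  rewrite defd ?det_mulmx ?c0 ?mulr0 // => i; rewrite nth_mktuple.
  by under eq_bigr do rewrite mxE; apply: free_coord.
have -> : embmx d = Vandermonde n (\row_j s j theta).
  by apply/matrixP=> i j; rewrite !mxE nth_mktuple rmorphXn.
rewrite det_Vandermonde => /eqP; rewrite prodf_seq_eq0 => /hasP[i _] /=.
rewrite prodf_seq_eq0 => /hasP[j _] /=; rewrite !mxE subr_eq0 => /andP[ltij /eqP].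
by move/s_inj => eqij; rewrite eqij ltnn in ltij.
Qed.

(** Conjugation by [embmx] diagonalizes the matrix of multiplication by x, with the conjugates of x
    as eigenvalues. *)
Lemma field_traceE x : ratr (field_trace x) = \sum_j s j x.
Proof.
rewrite /field_trace; set b := vbasis _; set M := (\matrix_(i, j) _).
have fb : free b by rewrite (basis_free (vbasisP _)).
pose d : n.-tuple k := [tuple x * b`_i | i < n].
have E1 : embmx d = map_mx ratr M *m embmx b.
  apply: embmx_mul => i; rewrite nth_mktuple.
  by under eq_bigr do rewrite mxE; apply: free_coord.
have E2 : embmx d = embmx b *m diag_mx (\row_j s j x).
  by apply: embmx_scale => i; rewrite nth_mktuple.
have Ub : embmx b \in unitmx by rewrite unitmxE unitfE det_embmx_neq0.
have -> : ratr (\tr M) = \tr (map_mx ratr M) :> C by rewrite trace_map_mx.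
rewrite -[map_mx _ _](mulmxK Ub) -E1 E2 mxtrace_mulC mulKmx //.
by rewrite mxtrace_diag; apply: eq_bigr => i _; rewrite mxE.
Qed.

Lemma basis_discE c : ratr (basis_disc c) = \det (embmx c) ^+ 2.
Proof.
rewrite /basis_disc -det_map_mx expr2 -[in X in _ * X]det_tr -det_mulmx; congr (\det _).
apply/matrixP=> i j; rewrite !mxE /= field_traceE; apply: eq_bigr => l _.
by rewrite rmorphM !mxE.
Qed.

Lemma basis_disc_neq0 c : free c -> basis_disc c != 0.
Proof.
move=> /det_embmx_neq0; apply: contraNneq => disc0.
by rewrite -sqrf_eq0 -basis_discE disc0 rmorph0.
Qed.

Lemma basis_disc_int c : (forall i : 'I_n, ring_of_integers k c`_i) ->
  basis_disc c \is a Num.int.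
Proof.
move=> intc; apply: (@integral_ratr_int C); rewrite basis_discE expr2.
suff intd : integralOver (intr : int -> C) (\det (embmx c)).
  exact: (mxpoly.integral_mul intd intd).
have int_sign m : integralOver (intr : int -> C) ((-1) ^+ m).
  have -> : (-1) ^+ m = ((-1) ^+ m : int)%:~R :> C by rewrite rmorphXn rmorphN.
  exact: (mxpoly.integral_id (intr : {rmorphism int -> C})).
rewrite /determinant; apply: (big_ind (@integralOver int C intr)) => [|a b|sg _].
- exact: (mxpoly.integral0 (intr : {rmorphism int -> C})).
- exact: (@mxpoly.integral_add _ _ (intr : {rmorphism int -> C}) a b).
apply: (@mxpoly.integral_mul _ _ (intr : {rmorphism int -> C})).
  exact: int_sign.
apply: (big_ind (@integralOver int C intr)) => [|a b|i _].
- exact: (mxpoly.integral1 (intr : {rmorphism int -> C})).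
- exact: (@mxpoly.integral_mul _ _ (intr : {rmorphism int -> C}) a b).
by rewrite mxE; apply: integral_rmorphism; apply: intc.
Qed.

End EmbeddingMatrix.

(** * Integral bases *)

Lemma common_denominator (I : finType) (q : I -> rat) :
  exists2 N : nat, (0 < N)%N & forall i, N%:R * q i \is a Num.int.
Proof.
pose N := (\prod_i absz (denq (q i)))%N.
exists N; first by apply: prodn_gt0 => i; rewrite absz_gt0 denq_neq0.
move=> i; rewrite /N (bigD1 i) //= natrM mulrAC rpredM ?rpred_nat //.
by rewrite natr_absz gtr0_norm ?denq_gt0 // mulrC -numqE intr_int.
Qed.

Lemma det_row_replace (F : comNzRingType) n (A : 'M[F]_n) (i : 'I_n) :
  (forall l j, l != i -> A l j = (l == j)%:R) -> \det A = A i i.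
Proof.
move=> rowA; rewrite (expand_det_row A i).
have adj1 : \adj (1%:M : 'M[F]_n) = 1%:M.
  by rewrite -[LHS]mul1mx mul_mx_adj det1.
have cofA j : cofactor A i j = (j == i)%:R.
  have -> : cofactor A i j = cofactor 1%:M i j.
    rewrite /cofactor; congr (_ * \det _); apply/matrixP => a b.
    by rewrite !mxE rowA // eq_sym neq_lift.
  by have /matrixP/(_ j i) := adj1; rewrite !mxE.
rewrite (bigD1 i) //= cofA eqxx mulr1 big1 ?addr0 // => j /negPf neq_ji.
by rewrite cofA neq_ji mulr0.
Qed.

Section Lattices.
Variable k : fieldExtType rat.
Local Notation n := (\dim {:k}).
Local Notation O := (ring_of_integers k).
Implicit Types (c : n.-tuple k) (L : set k).

Lemma ring_of_integersD x y : O x -> O y -> O (x + y).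
Proof. exact: (@mxpoly.integral_add _ _ (intr : {rmorphism int -> k})). Qed.

Lemma ring_of_integersB x y : O x -> O y -> O (x - y).
Proof. exact: (@mxpoly.integral_sub _ _ (intr : {rmorphism int -> k})). Qed.

Lemma ring_of_integersM x y : O x -> O y -> O (x * y).
Proof. exact: (@mxpoly.integral_mul _ _ (intr : {rmorphism int -> k})). Qed.

Lemma ring_of_integers_int (z : int) : O z%:~R.
Proof. exact: (mxpoly.integral_id (intr : {rmorphism int -> k})). Qed.

Lemma ring_of_integers0 : O 0. Proof. exact: (ring_of_integers_int 0). Qed.

Lemma ring_of_integers1 : O 1. Proof. exact: (ring_of_integers_int 1). Qed.

(** The row vector of the [c i] is an eigenvector of [A^T] for x, hence x is a root of a monic
    integer characteristic polynomial. *)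
Lemma integral_of_stable m (A : 'M[int]_m) (c : 'I_m -> k) x :
  (exists i, c i != 0) -> (forall i, x * c i = \sum_j c j *~ A i j) -> O x.
Proof.
move=> [i0 ci0] stable; exists (char_poly A^T); first exact: char_poly_monic.
rewrite map_char_poly -eigenvalue_root_char; apply/eigenvalueP.
exists (\row_j c j); last first.
  by apply: contraNneq ci0 => /rowP/(_ i0); rewrite !mxE => ->.
apply/rowP=> i; rewrite !mxE stable; apply: eq_bigr => j _.
by rewrite !mxE mulrzr.
Qed.

(** N clears the denominators of the matrix of multiplication by x, and [integral_of_stable] applies
    to N x. *)
Lemma exists_int_multiple x : exists2 N : nat, (0 < N)%N & O (N%:R * x).
Proof.
pose b := vbasis {:k}.
have fb : free b by rewrite (basis_free (vbasisP _)).
have [N N0 intN] := common_denominator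
  (fun ij : 'I_n * 'I_n => coord b ij.2 (x * b`_ij.1)).
exists N => //.
pose A : 'M[int]_n := \matrix_(i, j) numq (N%:R * coord b j (x * b`_i)).
apply: (@integral_of_stable n A (fun i => b`_i)).
  have n0 : (0 < n)%N by rewrite (adim_gt0 {:k}%AS).
  exists (Ordinal n0) => /=; apply: (free_not0 fb).
  exact: (memt_nth 0 b n0).
move=> i; rewrite -mulrA (free_coord (x * b`_i) fb) mulr_sumr.
apply: eq_bigr => j _; rewrite mxE.
rewrite -[RHS]scaler_int numqK ?intN //= ?(intN (i, j)) //.
by rewrite -scalerA scaler_nat mulr_natl.
Qed.

End Lattices.

Section ZBases.
Variable k : fieldExtType rat.
Local Notation n := (\dim {:k}).
Local Notation O := (ring_of_integers k).
Implicit Types (c : n.-tuple k) (L : set k).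

Lemma free_disc_neq0 c : free c -> basis_disc c != 0.
Proof.
have [theta [s [s_inj _]]] := complete_embeddings algC k.
exact: basis_disc_neq0 s_inj _.
Qed.

Lemma integral_disc_int c : (forall i : 'I_n, O c`_i) -> basis_disc c \is a Num.int.
Proof.
have [theta [s [s_inj _]]] := complete_embeddings algC k.
exact: basis_disc_int s_inj _.
Qed.

Lemma disc_mul (T : 'M[rat]_n) c c' :
  (forall i : 'I_n, c'`_i = \sum_j T i j *: c`_j) ->
  basis_disc c' = \det T ^+ 2 * basis_disc c.
Proof.
have [theta [s [s_inj _]]] := complete_embeddings algC k.
move=> /(embmx_mul s) defc'; apply: (fmorph_inj (ratr : {rmorphism rat -> algC})).
rewrite rmorphM rmorphXn /= !(basis_discE s_inj) defc' det_mulmx det_map_mx.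
by rewrite exprMn.
Qed.

Lemma free_disc c : basis_disc c != 0 -> free c.
Proof.
have [theta [s [s_inj _]]] := complete_embeddings algC k.
move=> disc0; apply/freeP => a suma0 i.
have Uc : embmx s c \in unitmx.
  rewrite unitmxE unitfE; apply: contraNneq disc0 => det0.
  by rewrite -(fmorph_eq0 (ratr : {rmorphism rat -> algC})) /= (basis_discE s_inj) det0 expr0n.
pose v : 'rV[algC]_n := \row_i ratr (a i).
have : v *m embmx s c = 0.
  apply/rowP=> j; rewrite !mxE -[RHS](rmorph0 (s j)) -suma0 rmorph_sum /=.
  by apply: eq_bigr => l _; rewrite !mxE rmorphZ_num.
move/(congr1 (mulmx^~ (invmx (embmx s c)))); rewrite mulmxK // mul0mx.
by move/rowP/(_ i); rewrite !mxE => /eqP; rewrite fmorph_eq0 => /eqP.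
Qed.

Definition zbasis L c := free c /\ L = [set x | inIntSpan c x].

Lemma zbasis_sum L c (z : 'I_n -> int) : zbasis L c -> L (\sum_(i < n) c`_i *~ z i).
Proof.
move=> [_ ->]; exists [ffun i => z i].
by apply: eq_bigr => i _; rewrite ffunE.
Qed.

Lemma zbasis_mem L c (i : 'I_n) : zbasis L c -> L c`_i.
Proof.
move=> cL; have := zbasis_sum (fun j => (j == i)%:Z) cL.
rewrite (bigD1 i) //= eqxx mulr1z big1 ?addr0 // => j /negPf ->.
by rewrite mulr0z.
Qed.

Lemma subr_closed_span L c : (forall x y, L x -> L y -> L (x - y)) ->
  (forall i : 'I_n, L c`_i) -> [set x | inIntSpan c x] `<=` L.
Proof.
move=> LB Lc x [a ->].
have n0 : (0 < n)%N by rewrite (adim_gt0 {:k}%AS).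
have L0 : L 0 by rewrite -(subrr c`_(Ordinal n0)); apply: LB.
have LN y : L y -> L (- y) by move=> Ly; rewrite -sub0r; apply: LB.
have LD y z : L y -> L z -> L (y + z).
  by move=> Ly Lz; rewrite -[z]opprK; apply: LB => //; apply: LN.
have LMn y m : L y -> L (y *+ m).
  by move=> Ly; elim: m => [|m IHm]; rewrite ?mulrS //; apply: LD.
apply: (big_ind L) => // i _; case: (a i) => m.
  exact: LMn.
by rewrite NegzE mulrNz; apply: LN; apply: LMn.
Qed.

(* An independent tuple of L with the least discriminant is a basis: replacing an
   entry by the reduction of y modulo the tuple multiplies the discriminant by the
   square of the fractional part of a coordinate of y. *)
Lemma exists_zbasis L : (forall x y, L x -> L y -> L (x - y)) -> L `<=` O ->
  (exists2 c : n.-tuple k, free c & forall i : 'I_n, L c`_i) -> exists c, zbasis L c.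
Proof.
move=> LB LO [c0 fc0 Lc0].
pose P m := `[< exists c : n.-tuple k, [/\ free c, forall i : 'I_n, L c`_i
  & absz (numq (basis_disc c)) = m] >].
have exP : exists m, P m by exists (absz (numq (basis_disc c0))); apply/asboolP; exists c0.
have [m /asboolP[c [fc Lc defm]] minm] := ex_minnP exP.
exists c; split=> //; apply/seteqP; split; last exact: subr_closed_span.
move=> y Ly; have [inty|] := pselect (forall i, coord c i y \is a Num.int).
  exists [ffun i => numq (coord c i y)]; rewrite {1}(free_coord y fc).
  by apply: eq_bigr => i _; rewrite ffunE -scaler_int numqK.
move=> /existsNP[i /negP nint]; exfalso.
pose y' := y - c`_i *~ Num.floor (coord c i y).
have Ly' : L y'.
  apply: (LB) => //; apply: (subr_closed_span (c := c) LB Lc) => /=.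
  exists [ffun j => if j == i then Num.floor (coord c i y) else 0 : int].
  rewrite (bigD1 i) //= ffunE eqxx big1 ?addr0 // => j /negPf neq_ji.
  by rewrite ffunE neq_ji mulr0z.
have coordy' : coord c i y' = coord c i y - (Num.floor (coord c i y))%:~R.
  by rewrite raddfB /= -scaler_int linearZ /= coord_free // eqxx mulr1.
pose c' : n.-tuple k := [tuple if j == i then y' else c`_j | j < n].
pose T : 'M[rat]_n := \matrix_(l, j) if l == i then coord c j y' else (l == j)%:R.
have defc' (l : 'I_n) : c'`_l = \sum_j T l j *: c`_j.
  rewrite nth_mktuple; under eq_bigr do rewrite mxE.
  case: eqVneq => [_|_]; first exact: free_coord.
  rewrite (bigD1 l) //= eqxx scale1r big1 ?addr0 // => j.
  by rewrite eq_sym => /negPf ->; rewrite scale0r.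
have detT : \det T = coord c i y'.
  rewrite (@det_row_replace _ _ _ i) ?mxE ?eqxx // => l j /negPf neq_li.
  by rewrite mxE neq_li.
have discc' := disc_mul defc'; rewrite detT coordy' in discc'.
have Lc' (j : 'I_n) : L c'`_j by rewrite nth_mktuple; case: ifP.
have [dn0 dint] := (free_disc_neq0 fc, integral_disc_int (fun i => LO _ (Lc i))).
have d'int := integral_disc_int (fun i => LO _ (Lc' i)).
set r := coord c i y - _ in discc'.
have /andP[r0 r1] : 0 < r < 1.
  have /andP[lef ltf] := floor_itv (coord c i y); rewrite intrD in ltf.
  rewrite /r subr_gt0 ltrBlDl ltf andbT lt_def lef andbT.
  by apply: contraNneq nint => ->; exact: intr_int.
have d'n0 : basis_disc c' != 0 by rewrite discc' mulf_neq0 // expf_neq0 ?gt_eqF.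
have : (m <= absz (numq (basis_disc c')))%N.
  by apply: minm; apply/asboolP; exists c'; split => //; exact: free_disc.
rewrite -defm leqNgt => /negP; apply.
rewrite -(ltr_nat rat) !natr_absz !intr_norm !numqK // discc' normrM.
rewrite gtr_pMl ?normr_gt0 // normrX ger0_norm ?ltW //.
by rewrite expr_lte1 // ltW.
Qed.

Lemma zbasis_scale L c a : a != 0 -> zbasis L c ->
  zbasis [set a * x | x in L] [tuple a * c`_i | i < n].
Proof.
move=> a0 [fc defL]; split.
  apply/freeP => u; under eq_bigr do rewrite nth_mktuple scalerAr.
  rewrite -mulr_sumr => /eqP; rewrite mulf_eq0 (negPf a0) /= => /eqP.
  by move/freeP: fc; apply.
rewrite defL; apply/seteqP; split => [_ [x [z -> <-]]|x [z ->]] /=.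
  exists z; rewrite mulr_sumr; apply: eq_bigr => i _.
  by rewrite nth_mktuple mulrzAr.
exists (\sum_(i < n) c`_i *~ z i); first by exists z.
rewrite mulr_sumr; apply: eq_bigr => i _; by rewrite nth_mktuple mulrzAr.
Qed.

Lemma exists_integral_basis : exists c, zbasis O c.
Proof.
apply: exists_zbasis => //; first exact: ring_of_integersB.
pose b := vbasis {:k}.
have fb : free b by rewrite (basis_free (vbasisP _)).
have [N N0 intN] : exists2 N : 'I_n -> nat, (forall i, (0 < N i)%N) &
    forall i, O ((N i)%:R * b`_i).
  have /fin_all_exists[N NP] : forall i : 'I_n, exists N : nat, (0 < N)%N /\ O (N%:R * b`_i).
    by move=> i; have [N] := exists_int_multiple b`_i; exists N.
  by exists N => i; case: (NP i).
exists [tuple (N i)%:R * b`_i | i < n]; last by move=> i; rewrite nth_mktuple.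
apply/freeP => u; under eq_bigr do
  rewrite nth_mktuple mulr_natl -scaler_nat scalerA.
move: fb => /freeP fb /fb u0 i; have /eqP := u0 i.
by rewrite mulf_eq0 pnatr_eq0 -[N i == 0%N]negbK -lt0n N0 orbF => /eqP.
Qed.

Lemma abs_discE : exists2 b, zbasis O b & abs_disc k = `|basis_disc b|.
Proof.
by eexists; first exact: (xgetI (vbasis {:k}) (projT2 (cid exists_integral_basis))).
Qed.

(** Multiplication by the denominator d moves I into the ring of integers, where [exists_zbasis]
    applies. The n independent elements that it asks for are an integral basis multiplied by d x,
    for some nonzero x in I. *)
Lemma fractional_ideal_zbasis I : fractional_ideal I -> exists c, zbasis I c.
Proof.
case=> [[x Ix x0] ID IM [d [Od d0 dI]]].
have [b [fb defO]] := exists_integral_basis.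
have Ob (i : 'I_n) : O b`_i by apply: zbasis_mem; split.
have IB y z : I y -> I z -> I (y - z).
  move=> Iy Iz; apply: ID => //; rewrite -mulN1r; apply: IM => //.
  exact: (ring_of_integers_int k (-1)).
have [c cP] : exists c, zbasis [set d * y | y in I] c.
  apply: exists_zbasis => [_ _ [y Iy <-] [z Iz <-]|_ [y Iy <-]|].
  - by exists (y - z); [apply: IB | rewrite mulrBr].
  - exact: dI.
  exists [tuple d * x * b`_i | i < n]; last first.
    move=> i; rewrite nth_mktuple -mulrA mulrC; exists (x * b`_i); last by rewrite mulrC.
    by rewrite mulrC; apply: IM.
  by have [] := zbasis_scale (mulf_neq0 d0 x0) (conj fb defO).
exists [tuple d^-1 * c`_i | i < n].
have := zbasis_scale (invr_neq0 d0) cP; congr (zbasis _ _).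
apply/seteqP; split => [_ [_ [y Iy <-] <-]|y Iy] /=; first by rewrite mulKf.
by exists (d * y); [exists y | rewrite mulKf].
Qed.

End ZBases.

(** * Indices and small elements of ideals *)

Section Index.
Variable k : fieldExtType rat.
Implicit Types A B D : set k.

(* The index of B in A is at least m. *)
Definition idx_ge A B (m : nat) := exists f : 'I_m -> k,
  (forall i, A (f i)) /\ (forall i j, B (f i - f j) -> i = j).

Lemma idx_ge_fintype A B (T : finType) (f : T -> k) :
  (forall i, A (f i)) -> (forall i j, B (f i - f j) -> i = j) -> idx_ge A B #|T|.
Proof.
move=> Af injf; exists (fun i => f (enum_val i)); split=> [//|i j /injf].
exact: enum_val_inj.
Qed.

Lemma idx_ge_mul A B D m p : (forall x y, A x -> A y -> A (x + y)) ->
  B `<=` A -> (forall x y, B x -> B y -> B (x - y)) ->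
  D `<=` B -> (forall x y, B x -> B y -> B (x + y)) ->
  idx_ge A B m -> idx_ge B D p -> idx_ge A D (m * p).
Proof.
move=> AD BA BB DB BD [f [Af injf]] [g [Bg injg]].
have -> : (m * p)%N = #|{: 'I_m * 'I_p}| by rewrite card_prod !card_ord.
apply: (@idx_ge_fintype _ _ _ (fun ij => f ij.1 + g ij.2)) => [[i j]|[i j] [i' j']] /=.
  by apply: AD => //; apply: BA.
move=> Dd; have eqi : i = i'.
  apply: injf; have := BD _ _ (DB _ Dd) (BB _ _ (Bg j') (Bg j)).
  by rewrite (_ : _ + _ = f i - f i'); last ring.
congr (_, _) => //; apply: injg; move: Dd; rewrite eqi.
by rewrite (_ : f i' + _ - _ = g j - g j'); last ring.
Qed.

Lemma idx_geS A B B' m : B' `<=` B -> idx_ge A B m -> idx_ge A B' m.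
Proof. by move=> sB [f [Af injf]]; exists f; split=> // i j /sB/injf. Qed.

Lemma idx_ge_le A B m m' : (m' <= m)%N -> idx_ge A B m -> idx_ge A B m'.
Proof.
move=> lem [f [Af injf]]; exists (f \o widen_ord lem); split=> [i|i j /injf/(congr1 val)] /=.
  exact: Af.
exact: val_inj.
Qed.

Lemma idx_ge_scale A B m (a : k) : idx_ge A B m ->
  a != 0 -> idx_ge [set a * x | x in A] [set a * x | x in B] m.
Proof.
move=> [f [Af injf]] a0; exists (fun i => a * f i); split=> [i|i j] /=.
  by exists (f i).
move=> [x Bx eqx]; apply: injf; suff <- : x = f i - f j by [].
by apply: (mulfI a0); rewrite eqx mulrBr.
Qed.

(* The first p multiples of an element of A outside B are incongruent modulo B. *)
Lemma idx_ge_prime A B (p : nat) : prime p ->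
  (forall x y, A x -> A y -> A (x + y)) -> A 0 ->
  (forall x y, B x -> B y -> B (x - y)) ->
  (forall x, A x -> B (x *+ p)) -> ~ (A `<=` B) -> idx_ge A B p.
Proof.
move=> pp AD A0 BB pA /existsNP[v /not_implyP[Av nBv]].
have A_n x m : A x -> A (x *+ m).
  by move=> Ax; elim: m => [|m IHm]; rewrite ?mulr0n // mulrS; apply: AD.
have B0 : B 0 by have := pA _ A0; rewrite mul0rn.
have BN x : B x -> B (- x) by move=> Bx; rewrite -sub0r; apply: BB.
have B_z x (z : int) : B x -> B (x *~ z).
  move=> Bx; have Bn m : B (x *+ m).
    elim: m => [|m IHm]; first by rewrite mulr0n.
    by rewrite mulrS -[_ + _]opprK opprD; apply: (BN); apply: (BB) => //; apply: (BN).
  by case: z => m; [exact: Bn | rewrite NegzE mulrNz; apply/BN/Bn].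
exists (fun i : 'I_p => v *+ i); split=> [i|i j Bij]; first exact: A_n.
apply: val_inj; apply: contrapT => /eqP neq_ij; apply: nBv.
wlog ltij : i j Bij neq_ij / (j < i)%N.
  move=> wl; have [ltij|ltji|eqij] := ltngtP (val i) (val j).
  - by apply: (wl j i); rewrite // 1?eq_sym // -opprB; apply: BN.
  - exact: (wl i j).
  - by rewrite eqij eqxx in neq_ij.
have cop : coprimez p%:Z (i - j)%N%:Z.
  rewrite coprimezE /= prime_coprime // gtnNdvd ?subn_gt0 //.
  by rewrite (leq_ltn_trans (leq_subr _ _)).
have /coprimezP[[u w] /= uw] := cop.
have -> : v = v *+ p *~ u + v *+ (i - j) *~ w.
  rewrite !pmulrn -!mulrzA -mulrzDr [X in X + _]mulrC [X in _ + X]mulrC uw.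
  by rewrite mulr1z.
have BD x y : B x -> B y -> B (x + y).
  by move=> Bx By; rewrite -[y]opprK; apply: BB => //; apply: BN.
apply: BD; apply: B_z; first exact: pA.
by rewrite mulrnBr // ltnW.
Qed.

End Index.

Section IndexDet.
Variable k : fieldExtType rat.
Local Notation n := (\dim {:k}).
Implicit Types (c : n.-tuple k) (L : set k).

(** The upper bound that complements the lower bounds [idx_ge]: B contains the sublattice with
    coordinate matrix X, whose index in L is |det X|. *)
Lemma idx_ge_det L (B : set k) c (X : 'M[int]_n) m : zbasis L c -> \det X != 0 ->
  (forall z : 'rV[int]_n, B (\sum_(i < n) c`_i *~ (z *m X) 0 i)) ->
  idx_ge L B m -> (m <= `|\det X|)%N.
Proof.
move=> [fc defL] detX subB [f [Lf injf]]; rewrite leqNgt; apply/negP => ltm.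
have /choice[g gP] : forall i, exists a : 'rV[int]_n, f i = \sum_(i < n) c`_i *~ a 0 i.
  move=> i; have := Lf i; rewrite defL => -[a ->]; exists (\row_i a i).
  by apply: eq_bigr => j _; rewrite mxE.
have [|i [j [/eqP + [z defz]]]] := @int_lattice_pigeonhole _ X 'I_m g detX.
  by rewrite card_ord.
apply; apply: injf; have := subB z; rewrite -defz; congr B.
rewrite !gP -sumrB; apply: eq_bigr => l _; by rewrite !mxE mulrzBr.
Qed.

End IndexDet.

(** * Real coordinates of the embeddings and Minkowski's bound for an ideal *)

Section ReIm.
Variable R : rcfType.
Implicit Types z : R[i].
Local Open Scope complex_scope.

Definition reim z : R := complex.Re z + complex.Im z.

Lemma reim_is_zmod_morphism : {morph reim : x y / x - y}.
Proof. by case=> a b [c d]; rewrite /reim /=; ring. Qed.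

HB.instance Definition _ :=
  GRing.isZmodMorphism.Build R[i] R reim reim_is_zmod_morphism.

(** The coefficients (1 - i)/2 and (1 + i)/2 have squares of sum 0 and twice their product is 1.
    This is what [square_root_involution] asks for. *)
Lemma reimE z :
  (reim z)%:C = (2^-1 -i* 2^-1) * z + (2^-1 +i* 2^-1) * conjc z.
Proof.
case: z => a b; apply/eqP; rewrite eq_complex /reim /=.
by apply/andP; split; apply/eqP; field.
Qed.

(** With p = Re z + Im z and q = Re z - Im z, one has |z|^2 = (p^2 + q^2)/2 <= (|p| + |q|)^2/2. This
    loss of sqrt 2 is the source of the factor 2^(r2). *)
Lemma normc_sq_le z : Normc.normc z <= Num.sqrt 2 * ((`|reim z| + `|reim (conjc z)|) / 2).
Proof.
have -> (e := (`|reim z| + `|reim (conjc z)|) / 2) :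
    Num.sqrt 2 * e = Num.sqrt (2 * e ^+ 2).
  by rewrite sqrtrM // sqrtr_sqr ger0_norm // divr_ge0 ?addr_ge0.
case: z => a b; rewrite /Normc.normc /reim /= ler_wsqrtr //.
set p := a + b; set q := a - b.
have -> : a ^+ 2 + b ^+ 2 = (`|p| ^+ 2 + `|q| ^+ 2) / 2.
  by rewrite !real_normK ?num_real // /p /q; field.
have := normr_ge0 p; have := normr_ge0 q; nra.
Qed.

Lemma normc_real z : conjc z = z -> Normc.normc z = `|reim z|.
Proof.
case: z => a b [] eqb; have -> : b = 0 by lra.
by rewrite /Normc.normc /reim /= expr0n !addr0 sqrtr_sqr.
Qed.

Lemma ratr_complex (q : rat) : ratr q = (ratr q : R)%:C :> R[i].
Proof. by rewrite (fmorph_rat (real_complex R)). Qed.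

End ReIm.

Lemma nth_root_exists (R : realType) (a : R) (n : nat) : 0 < a -> (0 < n)%N ->
  exists2 t : R, 0 < t & t ^+ n = a.
Proof.
move=> a0 n0; exists (a `^ n%:R^-1); first exact: powR_gt0.
by rewrite -powR_mulrn ?powR_ge0 // -powRrM mulVf ?powRr1 ?ltW // pnatr_eq0 -lt0n.
Qed.

Lemma square_root_involution (F : comNzRingType) n (a b : F) (P : 'M[F]_n) :
  a * a + b * b = 0 -> a * b + a * b = 1 -> P *m P = 1%:M ->
  (a%:M + b *: P) *m (a%:M + b *: P) = P.
Proof.
move=> ab0 ab1 PP; rewrite mulmxDr !mulmxDl -!scalemxAl -!scalemxAr PP.
rewrite !mul_scalar_mx !mul_mx_scalar -[a%:M]scalemx1 !scalerA [b * a]mulrC.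
by rewrite [X in _ + X]addrC addrACA -!scalerDl ab0 ab1 scale0r add0r scale1r.
Qed.

Section MinkowskiIdeal.
Variables (R : realType) (k : fieldExtType rat).
Local Notation n := (\dim {:k}).
Local Notation O := (ring_of_integers k).
Variables (s : 'I_n -> {rmorphism k -> R[i]}) (theta : k).
Hypothesis s_inj : injective (fun i => s i theta).
Variable pi : 'I_n -> 'I_n.
Hypothesis s_conj : forall i x, s (pi i) x = conjc (s i x).
Implicit Types (c : n.-tuple k) (I : set k).

Lemma conj_perm_K : involutive pi.
Proof. by move=> i; apply: s_inj; rewrite /= !s_conj conjcK. Qed.

(* A complex embedding and its conjugate contribute Re + Im and Re - Im, so that
   no choice of one embedding in each conjugate pair is needed. *)
Definition realmx c : 'M[R]_n := \matrix_(i, j) reim (s j c`_i).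

Local Notation alpha := (Complex 2^-1 (- 2^-1) : R[i]).
Local Notation beta := (Complex 2^-1 2^-1 : R[i]).
Let P : 'M[R[i]]_n := \matrix_(i, j) (i == pi j)%:R.

Lemma realmxE c :
  map_mx (real_complex R) (realmx c) = embmx s c *m (alpha%:M + beta *: P).
Proof.
apply/matrixP=> i j; rewrite mulmxDr mul_mx_scalar -scalemxAr !mxE.
rewrite [LHS](reimE (s j c`_i)); congr (_ + _ * _).
rewrite (bigD1 (pi j)) //= !mxE eqxx mulr1 s_conj big1 ?addr0 // => l.
by rewrite !mxE => /negPf ->; rewrite mulr0.
Qed.

(* The matrix of realmxE that changes sigma into Re sigma + Im sigma is a square
   root of the permutation matrix of the conjugation, hence a fourth root of 1. *)
Lemma det_realmx c : \det (realmx c) ^+ 2 = `|ratr (basis_disc c)|.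
Proof.
have PP : P *m P = 1%:M.
  apply/matrixP=> i j; rewrite !mxE (bigD1 (pi j)) //= !mxE eqxx mulr1 conj_perm_K big1 ?addr0 // => l.
  by rewrite !mxE => /negPf ->; rewrite mulr0.
set Q := alpha%:M + beta *: P.
have QQ : Q *m Q = P.
  apply: square_root_involution => //.
    by apply/eqP; rewrite eq_complex /=; apply/andP; split; apply/eqP; field.
  by apply/eqP; rewrite eq_complex /=; apply/andP; split; apply/eqP; field.
have AQ := realmxE c; rewrite -/Q in AQ.
move: Q QQ AQ => Q QQ AQ.
have detQ4 : \det Q ^+ 4 = 1.
  have -> : \det Q ^+ 4 = (\det Q * \det Q) * (\det Q * \det Q) by ring.
  by rewrite -det_mulmx QQ -det_mulmx PP det1.
have det4 : \det (realmx c) ^+ 4 = ratr (basis_disc c) ^+ 2.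
  apply: complexI; rewrite !rmorphXn /= -ratr_complex (basis_discE s_inj).
  have -> : (real_complex R (\det (realmx c))) = \det (map_mx (real_complex R) (realmx c)).
    by rewrite det_map_mx.
  by rewrite AQ det_mulmx exprMn detQ4 mulr1 -exprM.
have /eqP : (\det (realmx c) ^+ 2) ^+ 2 = `|ratr (basis_disc c)| ^+ 2 :> R.
  by rewrite -exprM det4 real_normK ?num_real.
by rewrite eqrXn2 ?sqr_ge0 // => /eqP.
Qed.

Lemma reim_sum c (v : 'rV[int]_n) j :
  reim (s j (\sum_(i < n) c`_i *~ v 0 i)) = (map_mx intr v *m realmx c) 0 j.
Proof.
rewrite !rmorph_sum raddf_sum /= !mxE; apply: eq_bigr => i _.
by rewrite !mxE rmorphMz raddfMz mulrzl.
Qed.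

(** Nonreal embeddings are counted one by one, not in conjugate pairs: the value is 2 r2, and
    [Num.sqrt 2 ^+ nb_complex] is 2^(r2). *)
Definition nb_complex : nat := #|[pred i | pi i != i]|.

(** Averaging |reim| over each embedding and its conjugate bounds every absolute value by [u] (up to
    sqrt 2 when nonreal) without changing the total sum, since [pi] is a bijection. The inequality
    of arithmetic and geometric means concludes. *)
Lemma prod_normc_le x :
  \prod_j Normc.normc (s j x) <=
  Num.sqrt 2 ^+ nb_complex * ((\sum_j `|reim (s j x)|) / n%:R) ^+ n.
Proof.
pose u j := (`|reim (s j x)| + `|reim (s (pi j) x)|) / 2.
have u0 j : 0 <= u j by rewrite divr_ge0 ?addr_ge0.
have sumu : \sum_j u j = \sum_j `|reim (s j x)|.
  have eqpi : \sum_j `|reim (s (pi j) x)| = \sum_j `|reim (s j x)|.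
    by rewrite [RHS](reindex_inj (inv_inj conj_perm_K)).
  by rewrite -mulr_suml big_split /= eqpi; lra.
have norm_ge0 j : 0 <= Normc.normc (s j x).
  by case: (s j x) => a b; apply: sqrtr_ge0.
apply: (@le_trans _ _ (\prod_j ((if pi j != j then Num.sqrt 2 else 1) * u j))).
  apply: ler_prod => j _; rewrite norm_ge0 /=; case: eqP => [pij|_] /=.
    have rx : conjc (s j x) = s j x by rewrite -s_conj pij.
    by rewrite mul1r (normc_real rx) /u pij; lra.
  by rewrite /u s_conj; apply: normc_sq_le.
rewrite big_split /= -big_mkcond /= prodr_const ler_wpM2l ?exprn_ge0 ?sqrtr_ge0 //.
rewrite -sumu; have [|+ _] := @leif_AGM R _ (mem 'I_n) u; first by move=> i _.
by rewrite card_ord.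
Qed.

(** The index of xO in I is |N(x)| divided by the norm of I. The norm of I, which is |det T|, also
    appears in the covolume of I and cancels, leaving a bound independent of I. *)
Lemma minkowski_ideal (c0 : R) I : 1 < c0 -> fractional_ideal I ->
  exists x, [/\ I x, x != 0 & forall m, idx_ge I [set x * a | a in O] m ->
    m%:R <= c0 * Num.sqrt 2 ^+ nb_complex * (n`!%:R / n%:R ^+ n) *
      Num.sqrt (ratr (abs_disc k))].
Proof.
move=> c01 FI; have [c cI] := fractional_ideal_zbasis FI.
have [fc defI] := cI.
have [b [fb defO] ->] := abs_discE k.
have n0 : (0 < n)%N by rewrite (adim_gt0 {:k}%AS).
pose T : 'M[rat]_n := \matrix_(i, j) coord b j c`_i.
have defc (i : 'I_n) : c`_i = \sum_j T i j *: b`_j.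
  by under eq_bigr do rewrite mxE; apply: free_coord.
have detb0 := det_embmx_neq0 s_inj fb.
have detT0 : \det T != 0.
  have := free_disc_neq0 fc; rewrite (disc_mul defc).
  by apply: contraNneq => ->; rewrite expr0n mul0r.
have detA : `|\det (realmx c)| = `|ratr (\det T)| * Num.sqrt (ratr `|basis_disc b|) :> R.
  have -> : ratr `|basis_disc b| = `|ratr (basis_disc b)| :> R by rewrite ratr_norm.
  rewrite -sqrtr_sqr det_realmx (disc_mul defc) rmorphM rmorphXn normrM /= normrX.
  by rewrite sqrtrM ?sqr_ge0 // sqrtr_sqr normr_id.
have T0 : 0 < `|ratr (\det T)| :> R by rewrite normr_gt0 fmorph_eq0.
have d0 : 0 < Num.sqrt (ratr `|basis_disc b|) :> R.
  by rewrite sqrtr_gt0 ltr0q normr_gt0 free_disc_neq0.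
have A0 : 0 < `|\det (realmx c)| by rewrite detA mulr_gt0.
have fact0 : 0 < n`!%:R :> R by rewrite ltr0n fact_gt0.
(* The linear forms theorem needs a strict inequality; the factor [c0] > 1 provides it and remains
   in the final bound. *)
have [t t0 tn] : exists2 t : R, 0 < t & t ^+ n = c0 * (n`!%:R * `|\det (realmx c)|).
  by apply: nth_root_exists; rewrite // !mulr_gt0 // (lt_trans _ c01).
have [|||v v0 lev] := @minkowski_linear_forms R n (realmx c) t.
- by rewrite -normr_gt0.
- by [].
- by rewrite tn ltr_pMl // mulr_gt0.
pose x := \sum_(i < n) c`_i *~ v 0 i.
have Ix : I x by apply: zbasis_sum cI.
have x0 : x != 0.
  apply: contraNneq v0 => x0; apply/eqP/rowP=> i; rewrite mxE.
  move: fc => /freeP/(_ (fun i => (v 0 i)%:~R)) H.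
  have /H/(_ i)/eqP : \sum_(i < n) (v 0 i)%:~R *: c`_i = 0.
    by apply: etrans x0; apply: eq_bigr => j _; rewrite scaler_int.
  by rewrite intr_eq0 => /eqP.
exists x; split=> // m idxm.
have Ob (i : 'I_n) : O b`_i by apply: zbasis_mem; split.
have [X defX] : exists X : 'M[int]_n, forall i : 'I_n, x * b`_i = \sum_(j < n) c`_j *~ X i j.
  have /choice[X XP] : forall i : 'I_n, exists a : 'rV[int]_n, x * b`_i = \sum_(j < n) c`_j *~ a 0 j.
    move=> i; have : I (x * b`_i) by rewrite mulrC; case: FI => _ _ IM _; apply: IM.
    rewrite defI => -[a ->]; exists (\row_j a j).
    by apply: eq_bigr => j _; rewrite mxE.
  by exists (\matrix_i X i) => i; rewrite XP; apply: eq_bigr => j _; rewrite mxE.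
pose xb : n.-tuple k := [tuple x * b`_i | i < n].
have E1 : embmx s xb = map_mx ratr (map_mx intr X) *m embmx s c.
  apply: embmx_mul => i; rewrite nth_mktuple defX; apply: eq_bigr => j _.
  by rewrite mxE scaler_int.
have E2 : embmx s xb = embmx s b *m diag_mx (\row_j s j x).
  by apply: embmx_scale => i; rewrite nth_mktuple.
have E3 : embmx s c = map_mx ratr T *m embmx s b by apply: embmx_mul.
(* The basis of xO is reached from that of O in two ways: by the diagonal matrix of the conjugates
   of x, or through I by the matrices X and T. Comparing determinants gives N(x) = det X det T. *)
have prodE : \prod_j s j x = ratr ((\det X)%:~R * \det T).
  have := congr1 determinant E1; rewrite E2 E3 !det_mulmx !det_map_mx det_diag.
  under eq_bigr do rewrite mxE.
  rewrite mulrC mulrA => /(mulIf detb0) ->; by rewrite rmorphM.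
have prod_normc : `|(\det X)%:~R| * `|ratr (\det T)| = \prod_j Normc.normc (s j x) :> R.
  apply: complexI.
  have -> : real_complex R (\prod_j Normc.normc (s j x)) = `|\prod_j s j x|.
    by rewrite rmorph_prod normr_prod.
  rewrite prodE ratr_complex normc_def /= expr0n addr0 sqrtr_sqr -normrM.
  by rewrite rmorphM /= ratr_int.
have detX0 : \det X != 0.
  rewrite -(intr_eq0 R) -normr_eq0; apply: contraTneq isT => X0.
  have : \prod_j s j x = 0.
    move: X0 => /eqP; rewrite normr_eq0 intr_eq0 => /eqP X0.
    by rewrite prodE X0 mul0r rmorph0.
  move/eqP/prodf_eq0 => [j _]; by rewrite fmorph_eq0 (negPf x0).
have lem : m%:R <= `|(\det X)%:~R| :> R.
  rewrite -intr_norm -[`|\det X|]/(`|\det X|%N%:Z) ler_nat.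
  apply: idx_ge_det cI detX0 _ idxm => z.
  exists (\sum_(i < n) b`_i *~ z 0 i); first by apply: zbasis_sum; split.
  rewrite mulr_sumr; under eq_bigr do rewrite mulrzAr defX mulrz_suml.
  rewrite exchange_big; apply: eq_bigr => i _ /=; rewrite mxE.
  rewrite mulrz_sumr; apply: eq_bigr => j _; by rewrite -mulrzA mulrC.
apply: (le_trans lem); rewrite -(ler_pM2r T0) prod_normc.
apply: le_trans (prod_normc_le x) _.
have lesum : \sum_j `|reim (s j x)| <= t.
  by apply: le_trans lev; apply: ler_sum => j _; rewrite reim_sum.
apply: (@le_trans _ _ (Num.sqrt 2 ^+ nb_complex * (t / n%:R) ^+ n)).
  have S0 : 0 <= \sum_j `|reim (s j x)| by apply: sumr_ge0.
  rewrite ler_wpM2l ?exprn_ge0 ?sqrtr_ge0 // lerXn2r ?nnegrE ?divr_ge0 ?ler0n ?(ltW t0) //.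
  by rewrite ler_pM2r // invr_gt0 ltr0n.
rewrite expr_div_n tn detA.
have E (e f g p q : R) : e * (c0 * (f * (p * q)) / g) = c0 * e * (f / g) * q * p by ring.
by rewrite E.
Qed.

End MinkowskiIdeal.

(** * Invertibility and factorization of ideals *)

Lemma fieldExt_natr_eq0 (k : fieldExtType rat) (N : nat) :
  (N%:R == 0 :> k) = (N == 0)%N.
Proof.
by have /pcharf0P -> := ftrans (pchar_lalg k) (pchar_num _).
Qed.

Section IdealProduct.
Variable k : fieldExtType rat.
Local Notation n := (\dim {:k}).
Local Notation O := (ring_of_integers k).
Implicit Types (A B D I J P Q : set k).

(** The additive span of the products, defined by its minimality: [prodI_min] then serves as
    induction principle, and no finite sums have to be rearranged. *)
Definition prodI A B : set k := [set x | forall S : set k, S 0 ->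
  (forall x y, S x -> S y -> S (x + y)) ->
  (forall a b, A a -> B b -> S (a * b)) -> S x].

Lemma prodI0 A B : prodI A B 0. Proof. by []. Qed.

Lemma prodID A B x y : prodI A B x -> prodI A B y -> prodI A B (x + y).
Proof. by move=> ABx ABy S S0 SD SM; apply: (SD); [apply: ABx | apply: ABy]. Qed.

Lemma prodI_mul A B a b : A a -> B b -> prodI A B (a * b).
Proof. by move=> Aa Bb S _ _; apply. Qed.

Lemma prodI_min A B (S : set k) : S 0 -> (forall x y, S x -> S y -> S (x + y)) ->
  (forall a b, A a -> B b -> S (a * b)) -> prodI A B `<=` S.
Proof. by move=> S0 SD SM x; apply. Qed.

Lemma prodI_sub A A' B B' : A `<=` A' -> B `<=` B' -> prodI A B `<=` prodI A' B'.
Proof.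
move=> sA sB; apply: prodI_min; [exact: prodI0 | exact: prodID |].
by move=> a b /sA Aa /sB Bb; apply: prodI_mul.
Qed.

Lemma prodIC A B : prodI A B = prodI B A.
Proof.
suff sub A' B' : prodI A' B' `<=` prodI B' A' by apply/seteqP; split.
apply: prodI_min; [exact: prodI0 | exact: prodID |].
by move=> a b Aa Bb; rewrite mulrC; apply: prodI_mul.
Qed.

Lemma prodIA A B D : prodI A (prodI B D) = prodI (prodI A B) D.
Proof.
apply/seteqP; split.
  apply: prodI_min; [exact: prodI0 | exact: prodID |] => a x Aa.
  move: x; apply: (@prodI_min B D (fun x => prodI (prodI A B) D (a * x))).
  - by rewrite mulr0; exact: prodI0.
  - by move=> x y; rewrite mulrDr; apply: prodID.
  - by move=> b d Bb Dd; rewrite mulrA; do 2![apply: prodI_mul => //].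
apply: prodI_min; [exact: prodI0 | exact: prodID |] => x d + Dd.
move: x; apply: (@prodI_min A B (fun x => prodI A (prodI B D) (x * d))).
- by rewrite mul0r; exact: prodI0.
- by move=> x y; rewrite mulrDl; apply: prodID.
- by move=> a b Aa Bb; rewrite -mulrA; do 2![apply: prodI_mul => //].
Qed.

Lemma fractional_idealD I x y : fractional_ideal I -> I x -> I y -> I (x + y).
Proof. by case=> _ ID _ _; apply: ID. Qed.

Lemma fractional_idealM I a x : fractional_ideal I -> O a -> I x -> I (a * x).
Proof. by case=> _ _ IM _; apply: IM. Qed.

Lemma fractional_ideal0 I : fractional_ideal I -> I 0.
Proof.
by case=> [[x Ix _] _ IM _]; rewrite -(mul0r x); apply: IM => //; apply: ring_of_integers0.
Qed.

Lemma fractional_idealN I x : fractional_ideal I -> I x -> I (- x).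
Proof.
move=> FI Ix; rewrite -mulN1r; apply: fractional_idealM => //.
exact: (ring_of_integers_int k (-1)).
Qed.

Lemma fractional_idealB I x y : fractional_ideal I -> I x -> I y -> I (x - y).
Proof. by move=> FI Ix Iy; apply: fractional_idealD => //; apply: fractional_idealN. Qed.

Lemma fractional_idealMz I x (z : int) : fractional_ideal I -> I x -> I (x *~ z).
Proof.
move=> FI Ix; rewrite -mulrzl; apply: fractional_idealM => //.
exact: ring_of_integers_int.
Qed.

Lemma fractional_ideal_O : fractional_ideal O.
Proof.
split.
- by exists 1; [exact: ring_of_integers1 | exact: oner_neq0].
- exact: ring_of_integersD.
- exact: ring_of_integersM.
- exists 1; split=> [||x]; [exact: ring_of_integers1 | exact: oner_neq0 |].
  by rewrite mul1r.
Qed.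

Lemma fractional_ideal_scale (a : k) I : a != 0 -> fractional_ideal I ->
  fractional_ideal [set a * x | x in I].
Proof.
move=> a0 FI; have [[x Ix x0] ID IM [d [Od d0 dI]]] := FI; split.
- by exists (a * x); [exists x | rewrite mulf_neq0].
- by move=> _ _ [y Iy <-] [z Iz <-]; exists (y + z); [apply: ID | rewrite mulrDr].
- by move=> r _ Or [y Iy <-]; exists (r * y); [apply: IM | rewrite mulrCA].
have [N N0 ON] := exists_int_multiple a^-1.
exists (d * (N%:R / a)); split.
- exact: ring_of_integersM.
- by rewrite !mulf_neq0 ?invr_eq0 // fieldExt_natr_eq0 -lt0n.
have ONn : O N%:R by exact: (ring_of_integers_int k N).
move=> _ [y Iy <-]; have -> : d * (N%:R / a) * (a * y) = N%:R * (d * y) by field.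
by apply: ring_of_integersM => //; apply: dI.
Qed.

Lemma fractional_ideal_prod I J : fractional_ideal I -> fractional_ideal J ->
  fractional_ideal (prodI I J).
Proof.
move=> FI FJ; have [[x Ix x0] ID IM [d [Od d0 dI]]] := FI.
have [[y Jy y0] JD JM [e [Oe e0 eJ]]] := FJ; split.
- by exists (x * y); [exact: prodI_mul | exact: mulf_neq0].
- exact: prodID.
- move=> a z Oa; move: z; apply: (@prodI_min I J (fun z => prodI I J (a * z))).
  + by rewrite mulr0; apply: prodI0.
  + by move=> u v; rewrite mulrDr; apply: prodID.
  + by move=> u v Iu Jv; rewrite mulrA; apply: prodI_mul => //; apply: IM.
exists (d * e); split; [exact: ring_of_integersM | exact: mulf_neq0 |].
apply: (@prodI_min I J (fun z => O (d * e * z))).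
- by rewrite mulr0; exact: ring_of_integers0.
- by move=> u v; rewrite mulrDr; exact: ring_of_integersD.
- by move=> u v Iu Jv; rewrite mulrACA; apply: ring_of_integersM; [apply: dI | apply: eJ].
Qed.

Lemma prodI1 I : fractional_ideal I -> prodI O I = I.
Proof.
move=> FI; apply/seteqP; split.
  apply: prodI_min; first exact: fractional_ideal0.
    by move=> x y; apply: fractional_idealD.
  by move=> a b; apply: fractional_idealM.
by move=> x Ix; rewrite -[x]mul1r; apply: prodI_mul => //; apply: ring_of_integers1.
Qed.

Lemma prodI_scale (a : k) I J :
  prodI [set a * x | x in I] J = [set a * x | x in prodI I J].
Proof.
apply/seteqP; split.
  apply: prodI_min.
  - by exists 0; [exact: prodI0 | rewrite mulr0].
  - by move=> _ _ [x ? <-] [y ? <-]; exists (x + y); [exact: prodID | rewrite mulrDr].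
  - move=> _ b [x Ix <-] Jb; exists (x * b); last by rewrite mulrA.
    exact: prodI_mul.
move=> _ [x + <-]; move: x.
apply: (@prodI_min I J (fun x => prodI [set a * z | z in I] J (a * x))).
- by rewrite mulr0; exact: prodI0.
- by move=> x y; rewrite mulrDr; exact: prodID.
- by move=> u v Iu Jv; rewrite mulrA; apply: prodI_mul => //; exists u.
Qed.

(** Modulo I the matrix 1 - b is the identity. In the expansion, the identity permutation
    contributes a term congruent to 1, and any other permutation has an off-diagonal factor, which
    lies in I. *)
Lemma det_one_minus I m (b : 'M[k]_m) : fractional_ideal I -> I `<=` O ->
  (forall i j, I (b i j)) -> I (1 - \det (1%:M - b)).
Proof.
move=> FI IO Ib.
have Oe i j : O ((1%:M - b) i j).
  rewrite !mxE; apply: ring_of_integersB; last exact/IO.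
  exact: (ring_of_integers_int k (i == j)).
have Op (Q : pred 'I_m) (F : 'I_m -> 'I_m) : O (\prod_(i | Q i) (1%:M - b) i (F i)).
  apply: (big_ind O) => //; [exact: ring_of_integers1 | exact: ring_of_integersM].
rewrite /determinant (bigD1 (1%g : 'S_m)) //= opprD addrA.
apply: fractional_idealB => //; last first.
  apply: (big_ind I); first exact: fractional_ideal0.
    by move=> x y; apply: fractional_idealD.
  move=> p p1; have [i pi] : exists i, p i != i.
    apply/existsP; apply: contraNT p1; rewrite negb_exists => /forallP fixp.
    by apply/eqP/permP => i; rewrite perm1; apply/eqP; have := fixp i; rewrite negbK.
  apply: fractional_idealM => //.
    rewrite -signr_odd; case: (odd _).
      exact: (ring_of_integers_int k (-1)).
    exact: ring_of_integers1.
  rewrite (bigD1 i) //= mulrC; apply: fractional_idealM => //.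
  by rewrite !mxE eq_sym (negPf pi) sub0r; apply: fractional_idealN.
rewrite odd_perm1 mul1r (eq_bigr (fun i => (1%:M - b) i i)); last first.
  by move=> i _; rewrite perm1.
suff : I (1 - \prod_i (1%:M - b) i i) /\ O (\prod_i (1%:M - b) i i).
  by case.
apply: (big_ind (fun x => I (1 - x) /\ O x)).
- by rewrite subrr; split; [exact: fractional_ideal0 | exact: ring_of_integers1].
- move=> x y [Ix Ox] [Iy Oy]; split; last exact: ring_of_integersM.
  have -> : 1 - x * y = (1 - x) + x * (1 - y) by ring.
  by apply: fractional_idealD => //; apply: fractional_idealM.
- move=> i _; split=> //; rewrite !mxE eqxx.
  by rewrite opprB addrCA subrr addr0.
Qed.

(* The determinant trick: multiplication by J fixes I, which is finitely generated. *)
Lemma prodI_cancel I J : fractional_ideal I -> fractional_ideal J ->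
  prodI I J = I -> J = O.
Proof.
move=> FI FJ IJ; have [c cI] := fractional_ideal_zbasis FI; have [fc defI] := cI.
have Ic (i : 'I_n) : I c`_i by apply: zbasis_mem; split.
have n0 : (0 < n)%N by rewrite (adim_gt0 {:k}%AS).
have c0 : exists i : 'I_n, c`_i != 0.
  by exists (Ordinal n0); apply: (free_not0 fc); apply: memt_nth.
(* Elements of J stabilize the lattice I, so they are integral. *)
have JO : J `<=` O.
  move=> y Jy; have Iyc (i : 'I_n) : I (y * c`_i).
    by rewrite -IJ mulrC; apply: prodI_mul.
  have /choice[a aP] : forall i : 'I_n, exists a : {ffun 'I_n -> int},
      y * c`_i = \sum_(j < n) c`_j *~ a j.
    by move=> i; have := Iyc i; rewrite {1}defI.
  apply: (@integral_of_stable k n (\matrix_(i, j) a i j) (fun i => c`_i)) => // i.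
  by rewrite aP; apply: eq_bigr => j _; rewrite mxE.
(* As I = IJ, elements of I are combinations of its basis with coefficients in J. For the basis
   itself these form a matrix [beta] with (1 - beta) c = 0, so det (1 - beta) = 0 and
   [det_one_minus] puts 1 in J. *)
have repI x : I x -> exists b : 'I_n -> k, (forall j, J (b j)) /\
    x = \sum_(j < n) b j * c`_j.
  rewrite -{1}IJ; apply: (@prodI_min I J (fun x => exists b : 'I_n -> k,
    (forall j, J (b j)) /\ x = \sum_(j < n) b j * c`_j)).
  - exists (fun=> 0); split=> [j|]; first exact: fractional_ideal0.
    by rewrite big1 // => j _; rewrite mul0r.
  - move=> _ _ [b [Jb ->]] [d [Jd ->]]; exists (fun j => b j + d j); split.
      by move=> j; apply: fractional_idealD.
    by rewrite -big_split; apply: eq_bigr => j _; rewrite mulrDl.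
  - move=> a b; rewrite {1}defI => -[z ->] Jb; exists (fun j => b *~ z j); split.
      by move=> j; apply: fractional_idealMz.
    rewrite mulr_suml; apply: eq_bigr => j _.
    by rewrite mulrzAl mulrC mulrzAl.
have /choice[b bP] := fun i : 'I_n => repI _ (Ic i).
pose beta : 'M[k]_n := \matrix_(i, j) b i j.
have det0 : \det (1%:M - beta) = 0.
  have [i ci0] := c0; apply/eqP; apply: contraTT isT => detn0; exfalso.
  have U : 1%:M - beta \in unitmx by rewrite unitmxE unitfE.
  pose C : 'cV[k]_n := \col_j c`_j.
  have bC : (1%:M - beta) *m C = 0.
    apply/colP => l; rewrite mulmxBl mul1mx !mxE.
    have [_ {1}->] := bP l; apply/eqP; rewrite subr_eq0; apply/eqP.
    by apply: eq_bigr => j _; rewrite !mxE.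
  move/(congr1 (mulmx (invmx (1%:M - beta)))): bC; rewrite mulKmx // mulmx0.
  by move/colP/(_ i); rewrite !mxE; apply/eqP.
have J1 : J 1.
  have := @det_one_minus J n beta FJ JO; rewrite det0 subr0; apply => i j.
  by rewrite mxE; case: (bP i).
apply/seteqP; split=> // x Ox; rewrite -[x]mulr1; exact: fractional_idealM.
Qed.

End IdealProduct.

(** * Invertible ideals and maximal ideals *)

Section Dedekind.
Variable k : fieldExtType rat.
Local Notation n := (\dim {:k}).
Local Notation O := (ring_of_integers k).
Implicit Types (A B D I J P Q : set k).

Definition scaleI (a : k) I : set k := [set a * x | x in I].

Lemma scaleI_scale a b I : scaleI a (scaleI b I) = scaleI (a * b) I.
Proof.
apply/seteqP; split=> [_ [_ [x Ix <-] <-]|_ [x Ix <-]].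
  by exists x; rewrite ?mulrA.
by exists (b * x); [exists x | rewrite mulrA].
Qed.

Lemma scale1I I : scaleI 1 I = I.
Proof.
by apply/seteqP; split=> [_ [x Ix <-]|x Ix]; [rewrite mul1r | exists x; rewrite ?mul1r].
Qed.

Lemma scaleVI a I : a != 0 -> scaleI a (scaleI a^-1 I) = I.
Proof. by move=> a0; rewrite scaleI_scale mulfV // scale1I. Qed.

Lemma idx_ge_natO N m : (0 < N)%N -> idx_ge O (scaleI N%:R O) m -> (m <= N ^ n)%N.
Proof.
move=> N0; have [b bO] := exists_integral_basis k; have [_ defO] := bO.
have detN : \det (N%:Z%:M : 'M[int]_n) = N%:Z ^+ n by rewrite det_scalar.
move=> idx; have := @idx_ge_det k O (scaleI N%:R O) b N%:Z%:M m bO.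
rewrite detN abszX; apply=> //; first by rewrite expf_neq0 // -lt0n.
move=> z; exists (\sum_(i < n) b`_i *~ z 0 i).
  exact: zbasis_sum.
rewrite mulr_sumr; apply: eq_bigr => i _.
by rewrite mul_mx_scalar !mxE mulr_natl pmulrn -mulrzA mulrC.
Qed.

(** Two of the m multiples 0, y, ..., (m - 1) y are congruent modulo O, and the difference of their
    coefficients divides m!. *)
Lemma not_idx_ge_multiple J m y : fractional_ideal J -> ~ idx_ge J O m -> J y ->
  O (m`!%:R * y).
Proof.
move=> FJ nidx Jy; apply: contrapT => nO; apply: nidx.
exists (fun i : 'I_m => y *+ i); split=> [i|i j Oij].
  by rewrite pmulrn; apply: fractional_idealMz.
apply: val_inj; apply: contrapT => /eqP neq_ij; apply: nO.
wlog ltij : i j Oij neq_ij / (j < i)%N.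
  move=> wl; have [ltij|ltji|eqij] := ltngtP (val i) (val j).
  - apply: (wl j i); rewrite // 1?eq_sym // -opprB.
    by apply: fractional_idealN => //; apply: fractional_ideal_O.
  - exact: (wl i j).
  - by rewrite eqij eqxx in neq_ij.
have /dvdnP[q ->] : (i - j %| m`!)%N.
  by rewrite dvdn_fact // subn_gt0 ltij (leq_trans (leq_subr _ _)) // ltnW.
rewrite natrM -mulrA; apply: ring_of_integersM; first exact: (ring_of_integers_int k q).
by rewrite mulr_natl mulrnBr // ltnW.
Qed.

(** By [not_idx_ge_multiple] each J lies between O and N^(-1) O with N = m!. It is thus determined
    by which of the finitely many representatives [v a] of N^(-1) O modulo O it contains. *)
Lemma overorder_pigeonhole m (J : nat -> set k) :
  (forall i, [/\ fractional_ideal (J i), O `<=` J i & ~ idx_ge (J i) O m]) ->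
  exists i j, (i < j)%N /\ J i = J j.
Proof.
move=> JP; have [b [fb defO]] := exists_integral_basis k.
pose N := m`!; have N0 : (0 < N)%N by apply: fact_gt0.
have Nn0 : N%:R != 0 :> k by rewrite fieldExt_natr_eq0 -lt0n.
pose v (a : {ffun 'I_n -> 'I_N}) : k := (\sum_(i < n) b`_i *+ a i) / N%:R.
pose code i : {set {ffun 'I_n -> 'I_N}} := [set a | `[< J i (v a) >]]%SET.
have code_inj i j : code i = code j -> J i `<=` J j.
  move=> eqc y Jy; have [FJi OJi idxi] := JP i; have [FJj OJj _] := JP j.
  have := not_idx_ge_multiple FJi idxi Jy; rewrite -/N defO => -[z defz].
  have ltN l : (`|(z l %% N)%Z| < N)%N.
    have N1 : N%:Z != 0 by rewrite -lt0n.
    by have := modz_ge0 (z l) N1; have := ltz_pmod (z l) (d := N%:Z); lia.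
  pose a : {ffun 'I_n -> 'I_N} := [ffun l => Ordinal (ltN l)].
  pose q := \sum_(l < n) b`_l *~ (z l %/ N)%Z.
  have Oq : O q.
    by apply: zbasis_sum; split.
  have defy : y = q + v a.
    apply: (mulfI Nn0); rewrite mulrDr /v mulrCA mulfV // mulr1 defz /q.
    rewrite mulr_sumr -big_split; apply: eq_bigr => l _ /=.
    rewrite ffunE /= mulr_natl !pmulrn -mulrzA -mulrzDr; congr (_ *~ _).
    have N1 : N%:Z != 0 by rewrite -lt0n.
    by rewrite gez0_abs ?modz_ge0 // -divz_eq.
  have : a \in code i.
    rewrite inE; apply/asboolP; have -> : v a = y - q by rewrite defy addrAC subrr add0r.
    by apply: fractional_idealB => //; apply: OJi.
  rewrite eqc inE => /asboolP Jv; rewrite defy.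
  by apply: fractional_idealD => //; apply: OJj.
pose K := #|{: {set {ffun 'I_n -> 'I_N}}}|.
have /injectivePn[i [j neq_ij eqc]] : ~~ injectiveb (fun i : 'I_K.+1 => code i).
  by apply/injectiveP => /leq_card; rewrite card_ord ltnn.
have eqJ : J i = J j by apply/seteqP; split; apply: code_inj.
have [lt|lt|eq] := ltngtP (val i) (val j).
- by exists i, j.
- by exists j, i.
- by move: neq_ij; rewrite -val_eqE /= eq eqxx.
Qed.

Section SmallIndex.
Variable M : nat.
(** The only input from the geometry of numbers, kept abstract; it is instantiated with M - 1 the
    integral part of kappa. *)
Hypothesis small_index : forall I, fractional_ideal I ->
  exists x, [/\ I x, x != 0 & ~ idx_ge I (scaleI x O) M].

Lemma class_representative I : fractional_ideal I -> exists x J,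
  [/\ x != 0, I = scaleI x J, fractional_ideal J, O `<=` J & ~ idx_ge J O M].
Proof.
move=> FI; have [x [Ix x0 nidx]] := small_index FI.
exists x, (scaleI x^-1 I); split=> //.
- by rewrite scaleVI.
- by apply: fractional_ideal_scale => //; rewrite invr_eq0.
- move=> a Oa; exists (a * x); first exact: fractional_idealM.
  by rewrite mulrC mulfK.
- move=> idx; apply: nidx; have := idx_ge_scale idx x0.
  by rewrite -!/(scaleI _ _) scaleVI.
Qed.

(* Two powers I^i and I^j with i < j have the same representative, and cancelling
   I^i makes I^(j - i) principal. *)
Lemma fractional_ideal_invertible I : fractional_ideal I ->
  exists2 J, fractional_ideal J & prodI I J = O.
Proof.
move=> FI; pose pow m := iter m (prodI I) O.
have Fpow m : fractional_ideal (pow m).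
  elim: m => [|m IHm]; first exact: fractional_ideal_O.
  exact: fractional_ideal_prod.
have powD m p : pow (m + p)%N = prodI (pow m) (pow p).
  elim: m => [|m IHm]; first by rewrite add0n prodI1.
  by rewrite addSn /= -/(pow _) IHm prodIA.
have /choice[x /choice[J JP]] := fun m => class_representative (Fpow m).
have [i [j [ltij eqJ]]] : exists i j, (i < j)%N /\ J i = J j.
  by apply: (@overorder_pigeonhole M) => i; case: (JP i).
have [xi0 defi _ _ _] := JP i; have [xj0 defj _ _ _] := JP j.
pose c := x i / x j; have c0 : c != 0 by rewrite mulf_neq0 ?invr_eq0.
have defj' : scaleI c (pow j) = pow i.
  by rewrite defj -eqJ scaleI_scale /c mulfVK // -defi.
(* The predecessor sets one factor I apart: c I^(m+1) = O makes c I^m the inverse. *)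
pose m := (j - i).-1; have defm : j = (i + m.+1)%N by rewrite /m prednK ?subn_gt0 // subnKC // ltnW.
exists (scaleI c (pow m)); first exact: fractional_ideal_scale.
have -> : prodI I (scaleI c (pow m)) = scaleI c (pow m.+1).
  by rewrite prodIC /scaleI prodI_scale prodIC.
apply: (prodI_cancel (Fpow i)); first exact: fractional_ideal_scale.
by rewrite prodIC /scaleI prodI_scale prodIC -powD -defm -[RHS]defj'.
Qed.

Lemma prodI_inj I J D : fractional_ideal I -> fractional_ideal J ->
  fractional_ideal D -> prodI I D = prodI J D -> I = J.
Proof.
move=> FI FJ FD eqD; have [E FE DE] := fractional_ideal_invertible FD.
rewrite -[I]prodI1 // -[J]prodI1 // -DE !(prodIC (prodI D E)) !prodIA.
by rewrite eqD.
Qed.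

Definition maximal_ideal P := [/\ fractional_ideal P, P `<=` O, ~ P 1 &
  forall Q, fractional_ideal Q -> Q `<=` O -> P `<=` Q -> ~ Q 1 -> Q `<=` P].

Lemma ideal_nat I : fractional_ideal I -> exists2 N : nat, (0 < N)%N & I N%:R.
Proof.
move=> FI; have [[x Ix x0] _ _ _] := FI.
have [N N0 ON] := exists_int_multiple x^-1; exists N => //.
by rewrite -[N%:R](mulfVK x0); apply: fractional_idealM.
Qed.

Lemma not_1_proper I : fractional_ideal I -> I `<=` O -> I <> O -> ~ I 1.
Proof.
move=> FI IO neqIO I1; apply: neqIO; apply/seteqP; split=> // x Ox.
by rewrite -[x]mulr1; apply: fractional_idealM.
Qed.

Lemma scaleI_sub I a : fractional_ideal I -> I a -> scaleI a O `<=` I.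
Proof. by move=> FI Ia _ [x Ox <-]; rewrite mulrC; apply: fractional_idealM. Qed.

Lemma idx_ge2 A B x : A 0 -> A x -> ~ B x -> (B (- x) -> B x) -> idx_ge A B 2.
Proof.
move=> A0 Ax nBx BN; have -> : 2%N = #|{: bool}| by rewrite card_bool.
apply: (@idx_ge_fintype _ _ _ _ (fun b : bool => if b then x else 0)); first by case.
by case=> [] [] //; rewrite ?subr0 ?sub0r // => /BN.
Qed.

(** Among the proper ideals containing I, one of least index is maximal, because a strictly larger
    proper ideal has at most half the index. Indices are finite here since I contains a positive
    integer N, and [O : NO] <= N^n. *)
Lemma exists_maximal_ideal I : fractional_ideal I -> I `<=` O -> ~ I 1 ->
  exists2 P, maximal_ideal P & I `<=` P.
Proof.
move=> FI IO nI1; have [N N0 IN] := ideal_nat FI.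
pose ok m := `[< exists P, [/\ fractional_ideal P, P `<=` O, ~ P 1, I `<=` P &
  ~ idx_ge O P m.+1] >].
have exok : exists m, ok m.
  exists (N ^ n)%N; apply/asboolP; exists I; split=> // idx.
  have := idx_ge_natO N0 (idx_geS (scaleI_sub FI IN) idx).
  by rewrite ltnn.
have [m /asboolP[P [FP PO nP1 IP nidx]] minm] := ex_minnP exok.
exists P => //; split=> // Q FQ QO PQ nQ1; apply: contrapT.
move=> /existsNP[x /not_implyP[Qx nPx]].
have idx2 : idx_ge Q P 2.
  apply: idx_ge2 Qx nPx _; first exact: fractional_ideal0.
  by move=> Px; rewrite -[x]opprK; apply: fractional_idealN.
have m0 : (0 < m)%N.
  rewrite lt0n; apply/eqP => m0; apply: nidx; rewrite m0.
  exists (fun=> 1); split=> [i|i j _]; first exact: ring_of_integers1.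
  by rewrite !ord1.
have nokQ : ~ ~ idx_ge O Q m.
  move=> nidxQ; have : ok m.-1 by apply/asboolP; exists Q; split=> //;
    [exact: subset_trans IP PQ | rewrite prednK].
  by move/minm; rewrite leqNgt prednK // leqnn.
apply: nokQ => idxQ; apply: nidx; apply: (@idx_ge_le _ _ _ (m * 2)).
  by rewrite muln2 -addnn -addn1 leq_add2l.
apply: idx_ge_mul idxQ idx2 => //.
- exact: ring_of_integersD.
- by move=> y z; apply: fractional_idealB.
- by move=> y z; apply: fractional_idealD.
Qed.

(** The least positive integer p of P is prime. Let p = e d with d outside P: maximality gives 1 = x
    + d y with x in P, so e = e x + y p is in P, and minimality gives e = p, d = 1. *)
Lemma maximal_ideal_prime P : maximal_ideal P -> exists2 p, prime p & P p%:R.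
Proof.
move=> [FP PO nP1 maxP]; have [N N0 PN] := ideal_nat FP.
pose ok m := `[< (0 < m)%N /\ P m%:R >].
have exok : exists m, ok m by exists N; apply/asboolP.
have [p /asboolP[p0 Pp] minp] := ex_minnP exok; exists p => //.
have p1 : (1 < p)%N.
  by case: p p0 Pp {minp} => [|[|p]] //.
apply/primeP; split=> // d /dvdnP[e defp].
have d0 : (0 < d)%N by case: d defp p0 => // ->; rewrite muln0.
have e0 : (0 < e)%N by case: e defp p0 => // ->; rewrite mul0n.
have [Pd|nPd] := pselect (P d%:R).
  have ledp : (d <= p)%N by rewrite defp leq_pmull.
  have lepd : (p <= d)%N by apply: minp; apply/asboolP.
  by apply/orP; right; rewrite eqn_leq ledp lepd.
have [Q1|nQ1] := pselect (exists2 x, P x & exists2 y, O y & 1 = x + d%:R * y).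
  have [x Px [y Oy def1]] := Q1.
  have Pe : P e%:R.
    have -> : e%:R = e%:R * x + y * p%:R.
      by rewrite defp natrM -[LHS]mulr1 [X in _ * X = _]def1; ring.
    apply: fractional_idealD => //; last exact: fractional_idealM.
    by apply: fractional_idealM => //; exact: (ring_of_integers_int k e).
  have lepe : (p <= e)%N by apply: minp; apply/asboolP.
  apply/orP; left; rewrite eqn_leq d0 andbT.
  by rewrite -(leq_pmul2l e0) -defp muln1.
exfalso; apply: nPd.
pose Q : set k := [set z | exists2 x, P x & exists2 y, O y & z = x + d%:R * y].
have PQ : P `<=` Q.
  by move=> x Px; exists x => //; exists 0; [exact: ring_of_integers0 | rewrite mulr0 addr0].
have Od : O d%:R by exact: (ring_of_integers_int k d).
have QO : Q `<=` O.
  move=> _ [x Px [y Oy ->]]; apply: ring_of_integersD; first exact: PO.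
  exact: ring_of_integersM.
apply: (maxP Q) => //; last first.
  exists 0; first exact: fractional_ideal0.
  by exists 1; [exact: ring_of_integers1 | rewrite add0r mulr1].
split.
- by have [[x Px x0] _ _ _] := FP; exists x => //; apply: PQ.
- move=> _ _ [x Px [y Oy ->]] [x' Px' [y' Oy' ->]].
  exists (x + x'); first exact: fractional_idealD.
  by exists (y + y'); [exact: ring_of_integersD | ring].
- move=> a _ Oa [x Px [y Oy ->]]; exists (a * x); first exact: fractional_idealM.
  by exists (a * y); [exact: ring_of_integersM | ring].
- exists 1; split=> [||x]; [exact: ring_of_integers1 | exact: oner_neq0 |].
  by rewrite mul1r; apply: QO.
Qed.

End SmallIndex.
End Dedekind.

(** * Factorization into maximal ideals and the code by tuples of integers *)

Lemma logn_prodn (T : eqType) (s : seq T) (Q : pred T) (F : T -> nat) p :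
  (forall x, x \in s -> prime (F x)) ->
  logn p (\prod_(x <- s | Q x) F x) = count (fun x => Q x && (F x == p)) s.
Proof.
elim: s => [|x s IHs] primeF; first by rewrite big_nil logn1.
have IH := IHs (fun y ys => primeF y (mem_behead (s := x :: s) ys)).
have px : prime (F x) by apply: primeF; rewrite mem_head.
rewrite big_cons /=; case: (Q x); rewrite //= ?add0n -?IH //.
rewrite lognM ?(prime_gt0 px) //; first by rewrite logn_prime // eq_sym.
rewrite big_seq_cond prodn_cond_gt0 // => y /andP[ys _].
by rewrite prime_gt0 // primeF // inE ys orbT.
Qed.

Section Factorization.
Variable k : fieldExtType rat.
Local Notation n := (\dim {:k}).
Local Notation O := (ring_of_integers k).
Implicit Types (A B D I J P Q : set k) (s : seq (set k)).

Definition prod_ideals s := foldr (@prodI k) O s.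

Lemma perm_prod_ideals s t : perm_eq s t -> prod_ideals s = prod_ideals t.
Proof.
move=> st; apply: (catCA_perm_ind (P := fun t => prod_ideals s = prod_ideals t)) st _ => //.
move=> s1 s2 s3 ->; rewrite /prod_ideals !foldr_cat.
elim: s1 => [|P s1 IHs] //=; rewrite IHs {IHs}.
elim: s2 => [|Q s2 IHs] //=; rewrite -{}IHs !prodIA.
by rewrite (prodIC P Q).
Qed.

Lemma prod_ideals_fractional s : (forall P, P \in s -> maximal_ideal P) ->
  fractional_ideal (prod_ideals s).
Proof.
elim: s => [|P s IHs] maxs; first exact: fractional_ideal_O.
apply: fractional_ideal_prod; first by case: (maxs P (mem_head _ _)).
by apply: IHs => Q Qs; apply: maxs; rewrite inE Qs orbT.
Qed.

Lemma prod_ideals_sub s : (forall P, P \in s -> maximal_ideal P) ->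
  prod_ideals s `<=` O.
Proof.
elim: s => [|P s IHs] maxs //=.
have [_ PO _ _] := maxs P (mem_head _ _).
rewrite -[X in _ `<=` X](prodI1 (fractional_ideal_O k)); apply: prodI_sub => //.
by apply: IHs => Q Qs; apply: maxs; rewrite inE Qs orbT.
Qed.

Lemma prodI_maximal_lt J P : fractional_ideal J -> maximal_ideal P ->
  prodI J P `<=` J /\ ~ (J `<=` prodI J P).
Proof.
move=> FJ [FP PO nP1 _]; have sub : prodI J P `<=` J.
  by rewrite -[X in _ `<=` X](prodI1 FJ) [X in _ `<=` X]prodIC; apply: prodI_sub.
split=> // sub'; apply: nP1.
have -> : P = O by apply: (prodI_cancel FJ FP); apply/seteqP; split.
exact: ring_of_integers1.
Qed.

Lemma idx_ge1 I J : fractional_ideal I -> idx_ge I J 1.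
Proof.
move=> FI; exists (fun=> 0); split=> [i|i j _]; first exact: fractional_ideal0.
by rewrite !ord1.
Qed.

(** Multiplying J by the factors one at a time gives a strictly decreasing chain down to O. The step
    from J to JP has index at least r P, because r P lies in P and so maps J into JP. *)
Lemma idx_ge_prod J s (r : set k -> nat) :
  (forall P, P \in s -> maximal_ideal P) ->
  (forall P, P \in s -> prime (r P) /\ P (r P)%:R) ->
  fractional_ideal J -> prodI J (prod_ideals s) = O ->
  idx_ge J O (\prod_(P <- s) r P)%N.
Proof.
elim: s J => [|P s IHs] J maxs rs FJ /= JsO.
  by rewrite big_nil; apply: idx_ge1.
have maxP := maxs P (mem_head _ _); have [pr Pr] := rs P (mem_head _ _).
have maxs' Q : Q \in s -> maximal_ideal Q by move=> Qs; apply: maxs; rewrite inE Qs orbT.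
have [FP PO _ _] := maxP; have [sub nsub] := prodI_maximal_lt FJ maxP.
have FJP := fractional_ideal_prod FJ FP.
have idx : idx_ge (prodI J P) O (\prod_(P <- s) r P)%N.
  apply: IHs => //; first by move=> Q Qs; apply: rs; rewrite inE Qs orbT.
  by rewrite -prodIA.
have OJP : O `<=` prodI J P.
  rewrite -JsO prodIA -[X in _ `<=` X](prodI1 FJP) [X in _ `<=` X]prodIC.
  by apply: prodI_sub => //; apply: prod_ideals_sub.
rewrite big_cons; apply: idx_ge_mul idx => //.
- by move=> x y; apply: fractional_idealD.
- by move=> x y; apply: fractional_idealB.
- by move=> x y; apply: fractional_idealD.
apply: idx_ge_prime => //.
- by move=> x y; apply: fractional_idealD.
- exact: fractional_ideal0.
- by move=> x y; apply: fractional_idealB.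
- by move=> x Jx; rewrite -mulr_natr; apply: prodI_mul.
Qed.

Lemma comaximal P P' : maximal_ideal P -> maximal_ideal P' -> P <> P' ->
  exists2 y, P' y & P (1 - y).
Proof.
move=> [FP PO nP1 maxP] [FP' P'O nP'1 maxP'] neqP; apply: contrapT => no.
pose S : set k := [set z | exists2 x, P x & exists2 y, P' y & z = x + y].
have PS : P `<=` S.
  by move=> x Px; exists x => //; exists 0; [exact: fractional_ideal0 | rewrite addr0].
have P'S : P' `<=` S.
  by move=> x Px; exists 0; [exact: fractional_ideal0 | exists x; rewrite ?add0r].
have SO : S `<=` O.
  by move=> _ [x Px [y Py ->]]; apply: ring_of_integersD; [exact: PO | exact: P'O].
have nS1 : ~ S 1.
  move=> [x Px [y Py def1]]; apply: no; exists y => //.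
  by rewrite def1 addrK.
have FS : fractional_ideal S.
  split.
  - by have [[x Px x0] _ _ _] := FP; exists x => //; apply: PS.
  - move=> _ _ [x Px [y Py ->]] [x' Px' [y' Py' ->]].
    exists (x + x'); first exact: fractional_idealD.
    by exists (y + y'); [exact: fractional_idealD | rewrite addrACA].
  - move=> a _ Oa [x Px [y Py ->]]; exists (a * x); first exact: fractional_idealM.
    by exists (a * y); [exact: fractional_idealM | rewrite mulrDr].
  - exists 1; split=> [||x]; [exact: ring_of_integers1 | exact: oner_neq0 |].
    by rewrite mul1r; apply: SO.
apply: neqP; apply/seteqP; split.
  exact: subset_trans PS (maxP' S FS SO P'S nS1).
exact: subset_trans P'S (maxP S FS SO PS nS1).
Qed.

(** Adding an ideal to the intersection multiplies its index in O by at least p, so the intersection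
    of s has index at least p^(size s). It contains pO, of index at most p^n. *)
Lemma maximal_ideals_over p s : prime p -> uniq s ->
  (forall P, P \in s -> maximal_ideal P /\ P p%:R) -> (size s <= n)%N.
Proof.
move=> pp us maxs.
pose Q (t : seq (set k)) : set k := [set x | O x /\ forall P, P \in t -> P x].
have QD (t : seq (set k)) : (forall P, P \in t -> maximal_ideal P /\ P p%:R) ->
    (forall x y, Q t x -> Q t y -> Q t (x + y)) /\ (forall x y, Q t x -> Q t y -> Q t (x - y)).
  move=> maxt; split=> x y [Ox Px] [Oy Py]; split.
  - exact: ring_of_integersD.
  - by move=> P Pt; have [[FP _ _ _] _] := maxt P Pt; apply: fractional_idealD; [|apply: Px|apply: Py].
  - exact: ring_of_integersB.
  - by move=> P Pt; have [[FP _ _ _] _] := maxt P Pt; apply: fractional_idealB; [|apply: Px|apply: Py].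
(* Chinese remainders: x lies in every ideal of t and is 1 modulo P, so meeting with P strictly
   shrinks the intersection. *)
have wit P (t : seq (set k)) : maximal_ideal P -> (forall P', P' \in t -> maximal_ideal P') ->
    P \notin t -> exists2 x, Q t x & P (1 - x).
  move=> maxP; have [FP PO _ _] := maxP; elim: t => [|P' t IHt] maxt.
    exists 1; first by split=> //; exact: ring_of_integers1.
    by rewrite subrr; apply: fractional_ideal0.
  rewrite inE negb_or => /andP[/eqP neqP nPt].
  have [|x [Ox Qx] P1x] := IHt _ nPt.
    by move=> P'' P''t; apply: maxt; rewrite inE P''t orbT.
  have maxP' := maxt P' (mem_head _ _); have [FP' P'O _ _] := maxP'.
  have [y P'y P1y] := comaximal maxP maxP' neqP.
  exists (x * y).
    split; first by apply: ring_of_integersM => //; apply: P'O.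
    move=> P''; rewrite inE => /orP[/eqP ->|P''t]; first exact: fractional_idealM.
    rewrite mulrC; have [FP'' _ _ _] : maximal_ideal P'' by apply: maxt; rewrite inE P''t orbT.
    by apply: fractional_idealM => //; [apply: P'O | apply: Qx].
  have -> : 1 - x * y = (1 - x) + x * (1 - y) by ring.
  by apply: fractional_idealD => //; apply: fractional_idealM.
have idx : idx_ge O (Q s) (p ^ size s)%N.
  elim: s us maxs => [|P s IHs] /=.
    by move=> _ _; rewrite expn0; apply: idx_ge1; apply: fractional_ideal_O.
  move=> /andP[nPs us] maxs.
  have maxs' P' : P' \in s -> maximal_ideal P' /\ P' p%:R.
    by move=> P's; apply: maxs; rewrite inE P's orbT.
  have [maxP Pp] := maxs P (mem_head _ _); have [FP PO nP1 _] := maxP.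
  rewrite expnSr; have [QsD QsB] := QD _ maxs'; have [QPsD QPsB] := QD _ maxs.
  apply: idx_ge_mul (IHs us maxs') _ => //.
  - exact: ring_of_integersD.
  - by move=> x [].
  - by move=> x [Ox Px]; split=> // P' P's; apply: Px; rewrite inE P's orbT.
  apply: idx_ge_prime => //.
  - split=> [|P' P's]; first exact: ring_of_integers0.
    by have [[FP' _ _ _] _] := maxs' P' P's; apply: fractional_ideal0.
  - move=> x [Ox Px]; split.
      by rewrite -mulr_natl; apply: ring_of_integersM => //; exact: (ring_of_integers_int k p).
    move=> P'; rewrite inE => /orP[/eqP ->|P's].
      by rewrite -mulr_natr mulrC mulrC; apply: fractional_idealM.
    by have [[FP' _ _ _] _] := maxs' P' P's; rewrite pmulrn; apply: fractional_idealMz => //; apply: Px.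
  move=> sub; have [|x Qx P1x] := wit P s maxP _ nPs.
    by move=> P' /maxs'[].
  apply: nP1; rewrite -[1](subrK x); apply: fractional_idealD => //.
  by have [_] := sub x Qx; apply; rewrite mem_head.
rewrite -(leq_exp2l _ _ (prime_gt1 pp)).
apply: (idx_ge_natO (prime_gt0 pp)); apply: idx_geS idx.
move=> _ [x Ox <-]; split.
  by apply: ring_of_integersM => //; exact: (ring_of_integers_int k p).
move=> P Ps; have [[FP _ _ _] Pp] := maxs P Ps.
by rewrite mulrC; apply: fractional_idealM.
Qed.

(** A duplicate-free list of maximal ideals with r P = p has at most n entries, and a longest one is
    complete. The label of P is its position there. *)
Lemma exists_labels (r : set k -> nat) :
  (forall P, maximal_ideal P -> prime (r P) /\ P (r P)%:R) ->
  exists lab : set k -> 'I_n, forall P P', maximal_ideal P -> maximal_ideal P' ->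
    r P = r P' -> lab P = lab P' -> P = P'.
Proof.
move=> rP.
have ex_l p : exists l : seq (set k), (size l <= n)%N /\
    forall P, maximal_ideal P -> r P = p -> P \in l.
  pose ok m := `[< exists l : seq (set k), [/\ uniq l, size l = m &
    forall P, P \in l -> maximal_ideal P /\ r P = p] >].
  have bound m : ok m -> (m <= n)%N.
    move=> /asboolP[[|P l] [ul <- maxl]] //.
    have [maxP rPp] := maxl P (mem_head _ _); have [pp _] := rP P maxP.
    apply: (@maximal_ideals_over p) => //; first by rewrite -rPp.
    by move=> P' /maxl[maxP' <-]; split=> //; case: (rP P' maxP').
  have exok : exists m, ok m by exists 0%N; apply/asboolP; exists [::].
  have [m okm maxm] := ex_maxnP exok bound.
  have /asboolP[l [ul szl maxl]] := okm; exists l; split; first by rewrite szl bound.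
  move=> P maxP rPp; apply: contrapT => /negP nPl.
  have : (m.+1 <= m)%N.
    apply: maxm; apply/asboolP; exists (P :: l); split=> /=; rewrite ?nPl ?szl //.
    by move=> P'; rewrite inE => /orP[/eqP ->|/maxl].
  by rewrite ltnn.
have n0 : (0 < n)%N by rewrite (adim_gt0 {:k}%AS).
have /choice[l lP] := ex_l.
(* The default of [insubd] is reached only when P is not maximal. *)
pose lab P : 'I_n := insubd (Ordinal n0) (index P (l (r P))).
have labE P : maximal_ideal P -> lab P = index P (l (r P)) :> nat.
  move=> maxP; have [szl /(_ P maxP erefl) Pl] := lP (r P).
  by rewrite val_insubd (leq_trans _ szl) ?index_mem.
exists lab => P P' maxP maxP' eqr /(congr1 val) /=; rewrite !labE // eqr.
have [_ Pl] := lP (r P').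
by move=> eqi; rewrite -[P](nth_index set0 (Pl P maxP eqr)) eqi nth_index // Pl.
Qed.

Section SmallIndex.
Variable M : nat.
Hypothesis small_index : forall I, fractional_ideal I ->
  exists x, [/\ I x, x != 0 & ~ idx_ge I (scaleI x O) M].

(** Induction on a strict bound m for [J : O]: if J is not O, its inverse lies in some maximal P, JP
    still contains O, and its index over O is at most half that of J. *)
Lemma exists_factorization m J : fractional_ideal J -> O `<=` J -> ~ idx_ge J O m ->
  exists2 s, (forall P, P \in s -> maximal_ideal P) & prodI J (prod_ideals s) = O.
Proof.
elim: m J => [|m IHm] J FJ OJ nidx.
  by exfalso; apply: nidx; apply: idx_ge_le (idx_ge1 O FJ).
have [eqJ|neqJ] := pselect (J = O).
  by exists [::] => //=; rewrite eqJ prodI1 //; apply: fractional_ideal_O.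
have [I FI JI] := fractional_ideal_invertible small_index FJ.
have J1 : J 1 by apply: OJ; exact: ring_of_integers1.
have IO : I `<=` O.
  by move=> x Ix; rewrite -JI -[x]mul1r; apply: prodI_mul.
have nI1 : ~ I 1.
  apply: not_1_proper => // eqI; apply: neqJ; rewrite -JI eqI prodIC prodI1 //.
have [P maxP IP] := exists_maximal_ideal FI IO nI1; have [FP PO _ _] := maxP.
have [sub nsub] := prodI_maximal_lt FJ maxP.
have FJP := fractional_ideal_prod FJ FP.
have OJP : O `<=` prodI J P by rewrite -JI; apply: prodI_sub.
have [|s maxs JPs] := IHm _ FJP OJP.
  move=> idx; apply: (nidx).
  have m0 : (0 < m)%N.
    rewrite lt0n; apply/eqP => m0; apply: nidx; rewrite m0; exact: (idx_ge1 O FJ).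
  apply: (@idx_ge_le _ _ _ (2 * m)); first by rewrite mul2n -addnn -addn1 leq_add2l.
  move: nsub => /existsNP[x /not_implyP[Jx nPx]].
  have idx2 : idx_ge J (prodI J P) 2.
    apply: idx_ge2 Jx nPx _; first exact: fractional_ideal0.
    by move=> Px; rewrite -[x]opprK; apply: (fractional_idealN FJP).
  apply: idx_ge_mul idx2 idx => //.
  - by move=> y z; apply: fractional_idealD.
  - by move=> y z; apply: fractional_idealB.
  - by move=> y z; apply: fractional_idealD.
exists (P :: s); last by rewrite /= prodIA.
by move=> Q; rewrite inE => /orP[/eqP ->|/maxs].
Qed.

(* The i-th entry of phi J is the product of the residue characteristics of the
   prime factors of J^-1 with label i; as distinct primes above p have distinct
   labels, p-adic valuations recover the multiplicities. *)
Lemma exists_tuple_code : exists phi : set k -> {ffun 'I_n -> nat},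
  (forall J, fractional_ideal J -> O `<=` J -> ~ idx_ge J O M ->
    (forall i, 0 < phi J i)%N /\ idx_ge J O (\prod_i phi J i)%N) /\
  (forall J J', fractional_ideal J -> O `<=` J -> ~ idx_ge J O M ->
    fractional_ideal J' -> O `<=` J' -> ~ idx_ge J' O M ->
    phi J = phi J' -> J = J').
Proof.
have /choice[r rP] : forall P : set k, exists p, maximal_ideal P ->
    prime p /\ P p%:R.
  move=> P; have [maxP|nmaxP] := pselect (maximal_ideal P); last by exists 0%N.
  by have [p pp Pp] := maximal_ideal_prime maxP; exists p.
have [lab labP] := exists_labels rP.
have /choice[f fP] : forall J : set k, exists s : seq (set k),
    fractional_ideal J -> O `<=` J -> ~ idx_ge J O M ->
    (forall P, P \in s -> maximal_ideal P) /\ prodI J (prod_ideals s) = O.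
  move=> J; have [[FJ OJ nidx]|no] :=
      pselect [/\ fractional_ideal J, O `<=` J & ~ idx_ge J O M].
    by have [s] := exists_factorization FJ OJ nidx; exists s.
  by exists [::] => FJ OJ nidx; exfalso; apply: no.
exists (fun J => [ffun i => \prod_(P <- f J | lab P == i) r P])%N.
split=> [J FJ OJ nidx|J J' FJ OJ nidx FJ' OJ' nidx' eqphi].
  have [maxs Js] := fP J FJ OJ nidx; split.
    move=> i; rewrite ffunE big_seq_cond prodn_cond_gt0 // => P /andP[Ps _].
    by have [pr _] := rP P (maxs P Ps); apply: prime_gt0.
  under eq_bigr do rewrite ffunE.
  have <- : (\prod_(P <- f J) r P = \prod_i \prod_(P <- f J | lab P == i) r P)%N.
    exact: partition_big.
  apply: idx_ge_prod => // P Ps; exact: rP (maxs P Ps).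
have [maxs Js] := fP J FJ OJ nidx; have [maxs' Js'] := fP J' FJ' OJ' nidx'.
have countE J0 P : (forall P, P \in f J0 -> maximal_ideal P) -> maximal_ideal P ->
    count_mem P (f J0) = logn (r P) (\prod_(Q <- f J0 | lab Q == lab P) r Q).
  move=> max0 maxP; rewrite logn_prodn; last by move=> Q /max0/rP[].
  apply: eq_in_count => Q Qf /=; apply/eqP/andP => [->|[/eqP eql /eqP eqr]] //.
  exact: labP (max0 _ Qf) maxP eqr eql.
have : perm_eq (f J) (f J').
  apply/allP => P.
  rewrite mem_cat => PJ; have maxP : maximal_ideal P.
    by case/orP: PJ => [/maxs|/maxs'].
  rewrite /= !countE //; move/ffunP/(_ (lab P)): eqphi.
  by rewrite !ffunE => ->.
move/perm_prod_ideals => eqs.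
apply: (prodI_inj small_index FJ FJ' (prod_ideals_fractional maxs)).
by rewrite Js eqs Js'.
Qed.

End SmallIndex.
End Factorization.

(** * Counting tuples and numerical bounds *)

Section Numerics.
Variable R : realType.
Implicit Types x y : R.

(** An upper bound for zeta(3/2): the first term plus the integral of x^(-3/2) from 3/2 to
    infinity. *)
Definition zeta32 : R := 1 + 2 / Num.sqrt (3 / 2).

(* Convexity: integrating x^(-3/2) over [m - 1/2, m + 1/2]. *)
Lemma pow32_telescope (m : R) : 1 <= m ->
  (m * Num.sqrt m)^-1 <= 2 / Num.sqrt (m - 2^-1) - 2 / Num.sqrt (m + 2^-1).
Proof.
move=> m1; set a := Num.sqrt (m - _); set b := Num.sqrt (m + _); set c := Num.sqrt m.
have a0 : 0 < a by rewrite sqrtr_gt0; lra.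
have b0 : 0 < b by rewrite sqrtr_gt0; lra.
have c0 : 0 < c by rewrite sqrtr_gt0; lra.
have a2 : a ^+ 2 = m - 2^-1 by rewrite sqr_sqrtr //; lra.
have b2 : b ^+ 2 = m + 2^-1 by rewrite sqr_sqrtr //; lra.
have c2 : c ^+ 2 = m by rewrite sqr_sqrtr //; lra.
have abm : a * b <= m.
  rewrite -(@ler_pXn2r _ 2) ?nnegrE ?mulr_ge0 ?(ltW a0) ?(ltW b0) //; last by lra.
  have -> : (a * b) ^+ 2 = m ^+ 2 - 4^-1 by rewrite exprMn a2 b2; field.
  lra.
have abc : a + b <= 2 * c.
  rewrite -(@ler_pXn2r _ 2) ?nnegrE ?mulr_ge0 ?addr_ge0 ?(ltW a0) ?(ltW b0) ?(ltW c0) //.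
  by rewrite exprMn c2 sqrrD a2 b2; lra.
have -> : 2 / a - 2 / b = 2 / (a * b * (a + b)).
  have ba : (b - a) * (a + b) = 1.
    have -> : (b - a) * (a + b) = b ^+ 2 - a ^+ 2 by ring.
    by rewrite a2 b2; field.
  apply: (mulIf (lt0r_neq0 (mulr_gt0 (mulr_gt0 a0 b0) (addr_gt0 a0 b0)))).
  rewrite mulfVK ?gt_eqF ?mulr_gt0 ?addr_gt0 //.
  transitivity (2 * ((b - a) * (a + b))); last by rewrite ba mulr1.
  by field; rewrite !gt_eqF.
rewrite -[_^-1]mul1r ler_pdivrMr ?mulr_gt0 //; last lra.
rewrite mulrAC ler_pdivlMr ?mul1r ?mulr_gt0 ?addr_gt0 //.
have : a * b * (a + b) <= m * (2 * c).
  by apply: ler_pM => //; rewrite ltW // ?mulr_gt0 ?addr_gt0.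
lra.
Qed.

Lemma sum_pow32_le N : \sum_(j < N) (j.+1%:R * Num.sqrt j.+1%:R)^-1 <= zeta32.
Proof.
have s0 : 0 <= 2 / Num.sqrt (3 / 2) :> R by rewrite divr_ge0 ?sqrtr_ge0.
case: N => [|N]; first by rewrite big_ord0 /zeta32; lra.
suff : \sum_(j < N.+1) (j.+1%:R * Num.sqrt j.+1%:R)^-1 <=
    zeta32 - 2 / Num.sqrt (N.+1%:R + 2^-1).
  have : 0 <= 2 / Num.sqrt (N.+1%:R + 2^-1) :> R by rewrite divr_ge0 ?sqrtr_ge0.
  lra.
elim: N => [|N IHN].
  rewrite big_ord1 sqrtr1 mulr1 invr1 /zeta32.
  have -> : 1 + 2^-1 = 3 / 2 :> R by field.
  lra.
rewrite big_ord_recr /=; have := @pow32_telescope N.+2%:R.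
have -> : N.+2%:R - 2^-1 = N.+1%:R + 2^-1 :> R by rewrite -[N.+2%:R]natr1; field.
have -> : 1 <= N.+2%:R :> R by rewrite ler1n.
move=> /(_ isT); move: IHN; set u := \sum_(j < N.+1) _; set v := 2 / _; set w := 2 / _.
move: (_ * _)^-1 => z; lra.
Qed.

Lemma zeta32_pow4 : 8 * zeta32 ^+ 4 <= 1923 / 5.
Proof.
have z : zeta32 <= 287 / 109.
  have s2 : Num.sqrt (3 / 2) ^+ 2 = 3 / 2 :> R by rewrite sqr_sqrtr //; lra.
  have : 0 <= Num.sqrt (3 / 2) :> R by apply: sqrtr_ge0.
  move: s2; rewrite /zeta32; set s := Num.sqrt _ => s2 s0.
  (* 109/89 is slightly below sqrt (3/2), and 1 + 2 * 89/109 = 287/109. *)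
  have les : 109 / 89 <= s by have [//|lts] := leP (109 / 89) s; nra.
  suff : 2 / s <= 178 / 109 by lra.
  by rewrite ler_pdivrMr //; lra.
have z0 : 0 <= zeta32 by rewrite addr_ge0 // divr_ge0 ?sqrtr_ge0.
have le4 (a b : R) : 0 <= a -> a <= b -> a ^+ 4 <= b ^+ 4.
  by move=> a0 ab; rewrite lerXn2r ?nnegrE // (le_trans a0).
by have := le4 _ _ z0 z; lra.
Qed.

Definition pow32 x : R := x * Num.sqrt x.

Lemma pow32M x y : 0 <= x -> pow32 (x * y) = pow32 x * pow32 y.
Proof. by move=> x0; rewrite /pow32 sqrtrM // mulrACA. Qed.

Lemma pow32_ge0 x : 0 <= x -> 0 <= pow32 x.
Proof. by move=> x0; rewrite mulr_ge0 ?sqrtr_ge0. Qed.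

Lemma pow32_gt0 x : 0 < x -> 0 < pow32 x.
Proof. by move=> x0; rewrite mulr_gt0 ?sqrtr_gt0. Qed.

Lemma ler_pow32 x y : 0 <= x -> x <= y -> pow32 x <= pow32 y.
Proof. by move=> x0 xy; rewrite ler_pM ?sqrtr_ge0 ?ler_wsqrtr. Qed.

Lemma pow32X x m : 0 <= x -> pow32 (x ^+ m) = pow32 x ^+ m.
Proof.
move=> x0; elim: m => [|m IHm]; first by rewrite /pow32 !expr0 sqrtr1 mulr1.
by rewrite !exprS pow32M // IHm.
Qed.

Lemma pow32_sqr x : 0 <= x -> pow32 x ^+ 2 = x ^+ 3.
Proof. by move=> x0; rewrite exprMn sqr_sqrtr // -exprSr. Qed.

(** Rankin's trick: each counted tuple has weight (N / product)^(3/2) >= 1, and the sum of the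
    weights over all tuples factors into n partial sums of zeta(3/2). The entry [f i] stands for the
    positive integer f i + 1. *)
Lemma card_bounded_tuples n N :
  #|[set f : {ffun 'I_n -> 'I_N} | (\prod_i (f i).+1 <= N)%N]%SET|%:R
    <= pow32 N%:R * zeta32 ^+ n.
Proof.
pose w (m : nat) : R := (pow32 m%:R)^-1.
have wM (I : Type) (r : seq I) (F : I -> nat) :
    w (\prod_(i <- r) F i)%N = \prod_(i <- r) w (F i).
  elim: r => [|i r IHr]; first by rewrite !big_nil /w /pow32 sqrtr1 mulr1 invr1.
  by rewrite !big_cons -IHr /w natrM pow32M ?ler0n // invfM.
have N0 : 0 <= pow32 N%:R by apply: pow32_ge0; apply: ler0n.
apply: (@le_trans _ _ (\sum_(f : {ffun 'I_n -> 'I_N}) pow32 N%:R * \prod_i w (f i).+1)).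
  rewrite -sum1_card natr_sum [leLHS]big_mkcond /=; apply: ler_sum => f _.
  have w0 : 0 <= \prod_i w (f i).+1.
    by apply: prodr_ge0 => i _; rewrite invr_ge0 pow32_ge0 ?ler0n.
  case: ifP => [|_]; last exact: mulr_ge0.
  rewrite inE => leN; rewrite -wM /w ler_pdivlMr ?mul1r; last first.
    by rewrite pow32_gt0 // ltr0n prodn_gt0.
  by rewrite ler_pow32 ?ler0n // ler_nat.
rewrite -mulr_sumr ler_wpM2l //.
rewrite -(bigA_distr_bigA (fun (_ : 'I_n) (j : 'I_N) => w j.+1)) /=.
rewrite prodr_const card_ord lerXn2r ?nnegrE //.
- by apply: sumr_ge0 => j _; rewrite invr_ge0 pow32_ge0 ?ler0n.
- by rewrite addr_ge0 // divr_ge0 ?sqrtr_ge0.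
- exact: sum_pow32_le.
Qed.

Definition comp_exp (n : nat) : R := (1 + n%:R^-1) ^+ n.

(** Write 1 + 1/(n+1) = (1 + 1/n)(1 - y) with y = (n+1)^(-2). Bernoulli gives (1 - y)^(n+1) >= 1 -
    1/(n+1), which is the inverse of 1 + 1/n. *)
Lemma comp_expS n : (0 < n)%N -> comp_exp n <= comp_exp n.+1.
Proof.
move=> n0; rewrite /comp_exp; have n0' : 0 < n%:R :> R by rewrite ltr0n.
set p : R := n%:R in n0' *; have Sp : n.+1%:R = p + 1 by rewrite natr1.
pose y : R := (p + 1) ^- 2.
have p1 : 0 < p + 1 by lra.
have y0 : 0 <= y by rewrite invr_ge0 exprn_ge0 // ltW.
have y1 : y <= 1 by rewrite invf_le1 ?exprn_gt0 // exprn_ege1 //; lra.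
have bern (z : R) m : 0 <= z -> z <= 1 -> 1 - m%:R * z <= (1 - z) ^+ m.
  move=> z0 z1; elim: m => [|m IHm]; first by rewrite mul0r subr0 expr0.
  rewrite exprS -natr1 (le_trans _ (ler_wpM2l _ IHm)) ?subr_ge0 //.
  have mz2 : 0 <= m%:R * z * z by rewrite !mulr_ge0 ?ler0n.
  lra.
have -> : 1 + n.+1%:R^-1 = (1 + p^-1) * (1 - y).
  by rewrite Sp /y; field; rewrite !gt_eqF.
rewrite exprMn [X in _ <= X * _]exprSr -mulrA ler_peMr ?exprn_ge0 //.
  by rewrite addr_ge0 // invr_ge0 ltW.
apply: le_trans (ler_wpM2l _ (bern y n.+1 y0 y1)); last first.
  by rewrite addr_ge0 // invr_ge0 ltW.
rewrite Sp /y.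
have -> : (1 + p^-1) * (1 - (p + 1) * (p + 1) ^- 2) = 1; last by [].
by field; rewrite !gt_eqF.
Qed.

Lemma comp_exp_mono m j : (0 < m)%N -> comp_exp m <= comp_exp (m + j).
Proof.
move=> m0; elim: j => [|j IHj]; first by rewrite addn0.
by rewrite addnS (le_trans IHj) // comp_expS // addn_gt0 m0.
Qed.

Definition fact_ratio (n : nat) : R := n`!%:R / n%:R ^+ n.

Lemma fact_ratio_ge0 n : 0 <= fact_ratio n.
Proof. by rewrite divr_ge0 ?exprn_ge0 ?ler0n. Qed.

Lemma fact_ratioS n : (0 < n)%N -> fact_ratio n.+1 * comp_exp n = fact_ratio n.
Proof.
move=> n0; have n0' : 0 < n%:R :> R by rewrite ltr0n.
rewrite /fact_ratio /comp_exp factS natrM.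
have -> : 1 + n%:R^-1 = n.+1%:R / n%:R :> R.
  by rewrite -natr1; field; rewrite gt_eqF.

have -> : (n.+1%:R / n%:R) ^+ n = n.+1%:R ^+ n / n%:R ^+ n :> R by rewrite expr_div_n.
have Sn0 : n.+1%:R != 0 :> R by rewrite pnatr_eq0.
have nn0 : n%:R ^+ n != 0 :> R by rewrite expf_neq0 // gt_eqF.
have Snn0 : n.+1%:R ^+ n != 0 :> R by rewrite expf_neq0.
rewrite exprS; move: nn0 Snn0 Sn0.
set a : R := n%:R ^+ n; set b : R := n.+1%:R ^+ n; set c : R := n.+1%:R.
by move: a b c => a b c a0 b0 c0; field; rewrite ?a0 ?b0 ?c0.
Qed.

(* An upper bound of 8 zeta32^4; it is less than e^6, so growth is bounded. *)
Definition growth_base : R := 1923 / 5.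

Lemma growth_base_ge0 : 0 <= growth_base.
Proof. by rewrite /growth_base; lra. Qed.

Definition growth n : R := fact_ratio n ^+ 6 * growth_base ^+ n.

Lemma growth_ge0 n : 0 <= growth n.
Proof.
exact: mulr_ge0 (exprn_ge0 6 (fact_ratio_ge0 n)) (exprn_ge0 n growth_base_ge0).
Qed.

(** The ratio growth (n+1) / growth n is [growth_base] / comp_exp(n)^6. It does not increase with n,
    so a bound [rho] valid at n0 stays valid. *)
Lemma growth_dyadic n0 (rho C : R) : (0 < n0)%N -> 1 <= rho ->
  growth_base <= rho * comp_exp n0 ^+ 6 -> growth n0 <= C ->
  forall j, growth (n0 + j) <= rho ^+ j * C.
Proof.
move=> n00 rho1 le_rho leC; elim=> [|j IHj]; first by rewrite addn0 expr0 mul1r.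
rewrite addnS; set n := (n0 + j)%N in IHj *; have n_gt0 : (0 < n)%N by rewrite addn_gt0 n00.
have c0 m : 0 < comp_exp m by rewrite exprn_gt0 // ltr_wpDr // invr_ge0 ler0n.
have eqg : growth n.+1 * comp_exp n ^+ 6 = growth_base * growth n.
  rewrite /growth -(fact_ratioS n_gt0) [(_ * comp_exp n) ^+ 6]exprMn [growth_base ^+ n.+1]exprS.
  move: (fact_ratio n.+1 ^+ 6) (comp_exp n ^+ 6) (growth_base ^+ n) => a b d; ring.
have le_rho' : growth_base <= rho * comp_exp n ^+ 6.
  rewrite (le_trans le_rho) // ler_wpM2l //; first by rewrite (le_trans _ rho1).
  by apply: lerXn2r (comp_exp_mono j n00); rewrite nnegrE ltW.
rewrite exprS -mulrA; apply: (@le_trans _ _ (rho * growth n)); last first.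
  by rewrite ler_wpM2l // (le_trans _ rho1).
rewrite -(ler_pM2r (exprn_gt0 6 (c0 n))) eqg.
rewrite [leRHS]mulrAC; exact: (ler_wpM2r (growth_ge0 n) le_rho').
Qed.

(** The ratio is bounded afresh at each power of 2: every [rho] is a rational slightly above
    growth_base / comp_exp(n0)^6, and every bound is rounded up to keep the numbers small. *)
Lemma growth_le n : (0 < n)%N -> growth n <= 10 ^+ 8.
Proof.
have step n0 n1 (rho C : R) : (0 < n0)%N -> 1 <= rho ->
    growth_base <= rho * comp_exp n0 ^+ 6 -> growth n0 <= C ->
    forall m, (n0 <= m <= n1)%N -> growth m <= rho ^+ (n1 - n0) * C.
  move=> n00 rho1 le_rho leC m /andP[le1 le2].
  have := growth_dyadic n00 rho1 le_rho leC (m - n0); rewrite subnKC //.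
  move/le_trans; apply; apply: ler_wpM2r.
    exact: le_trans (growth_ge0 n0) leC.
  by apply: ler_weXn2l => //; rewrite leq_sub2r.
have g1 : growth 1 <= growth_base.
  by rewrite /growth /fact_ratio (_ : (1`! = 1)%N) // expr1 divr1 expr1n mul1r expr1.
have s1 m : (1 <= m <= 2)%N -> growth m <= 24 * 10 ^+ 2.
  move=> lem; apply: le_trans (step 1%N 2%N (601 / 100) _ isT _ _ g1 m lem) _;
  by rewrite /comp_exp /growth_base; lra.
have s2 m : (2 <= m <= 4)%N -> growth m <= 22 * 10 ^+ 3.
  move=> lem; apply: le_trans (step 2%N 4%N (593 / 200) _ isT _ _ (s1 2%N isT) m lem) _;
  by rewrite /comp_exp /growth_base; lra.
have s3 m : (4 <= m <= 8)%N -> growth m <= 24 * 10 ^+ 4.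
  move=> lem; apply: le_trans (step 4%N 8%N (1817 / 1000) _ isT _ _ (s2 4%N isT) m lem) _;
  by rewrite /comp_exp /growth_base; lra.
have s4 m : (8 <= m <= 16)%N -> growth m <= 27 * 10 ^+ 5.
  move=> lem; apply: le_trans (step 8%N 16%N (337 / 250) _ isT _ _ (s3 8%N isT) m lem) _;
  by rewrite /comp_exp /growth_base; lra.
have s5 m : (16 <= m <= 32)%N -> growth m <= 23 * 10 ^+ 6.
  move=> lem; apply: le_trans (step 16%N 32%N (2283 / 2000) _ isT _ _ (s4 16%N isT) m lem) _;
  by rewrite /comp_exp /growth_base; lra.
have s6 m : (32 <= m <= 64)%N -> growth m <= 10 ^+ 8.
  move=> lem; apply: le_trans (step 32%N 64%N (2091 / 2000) _ isT _ _ (s5 32%N isT) m lem) _;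
  by rewrite /comp_exp /growth_base; lra.
(* From 64 on comp_exp^6 exceeds [growth_base], so [growth] no longer increases. *)
have s7 m : (64 <= m)%N -> growth m <= 10 ^+ 8.
  have le1 : growth_base <= 1 * comp_exp 64 ^+ 6.
    by rewrite /comp_exp /growth_base; lra.
  move=> lem; have := @growth_dyadic 64%N 1 _ isT (lexx 1) le1 (s6 64%N isT) (m - 64)%N.
  by rewrite subnKC // expr1n mul1r.
move=> n0; have [n64|n64] := leqP 64 n; first by apply: le_trans (s7 n n64) _; lra.
have [n32|n32] := leqP 32 n.
  by apply: le_trans (s6 n _) _; [rewrite n32 ltnW | lra].
have [n16|n16] := leqP 16 n.
  by apply: le_trans (s5 n _) _; [rewrite n16 ltnW | lra].
have [n8|n8] := leqP 8 n.
  by apply: le_trans (s4 n _) _; [rewrite n8 ltnW | lra].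
have [n4|n4] := leqP 4 n.
  by apply: le_trans (s3 n _) _; [rewrite n4 ltnW | lra].
have [n2|n2] := leqP 2 n.
  by apply: le_trans (s2 n _) _; [rewrite n2 ltnW | lra].
by apply: le_trans (s1 n _) _; [rewrite n0 ltnW | lra].
Qed.

(* Raised to the fourth power this is growth_le, as (sqrt 2)^(3/2) >= 1.64. *)
Lemma final_constant (n nc r1 : nat) : (0 < n)%N -> (r1 + nc <= n)%N ->
  pow32 (3 / 2) * pow32 (Num.sqrt 2) ^+ nc * pow32 (fact_ratio n) * zeta32 ^+ n
    <= 242 / (164 / 100) ^+ r1.
Proof.
move=> n0 len; set tau := pow32 (Num.sqrt 2).
have root4 (x y : R) : 0 <= x -> 0 <= y -> x ^+ 4 <= y ^+ 4 -> x <= y.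
  by move=> x0 y0; rewrite ler_pXn2r ?nnegrE.
have s2 : 0 <= Num.sqrt 2 :> R by apply: sqrtr_ge0.
have tau0 : 0 <= tau by apply: pow32_ge0.
have tau4 : tau ^+ 4 = 8.
  by rewrite (exprM tau 2 2) pow32_sqr // -exprM (exprM _ 2 3) sqr_sqrtr //; lra.
have q0 : 0 <= 164 / 100 :> R by lra.
have letau : 164 / 100 <= tau.
  by apply: root4 => //; rewrite tau4; lra.
have z0 : 0 <= zeta32 by rewrite addr_ge0 // divr_ge0 ?sqrtr_ge0.
have f0 : 0 <= pow32 (fact_ratio n) by apply/pow32_ge0/fact_ratio_ge0.
have c0 : 0 <= pow32 (3 / 2) by apply: pow32_ge0; lra.
rewrite ler_pdivlMr; last by apply: exprn_gt0; lra.
apply: (@le_trans _ _ (pow32 (3 / 2) * tau ^+ n * pow32 (fact_ratio n) * zeta32 ^+ n)).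
  have letn : tau ^+ nc * (164 / 100) ^+ r1 <= tau ^+ n.
    apply: (@le_trans _ _ (tau ^+ nc * tau ^+ r1)).
      apply: ler_wpM2l; first exact: exprn_ge0.
      by apply: lerXn2r letau; rewrite nnegrE.
    rewrite -exprD; apply: ler_weXn2l; first lra.
    by rewrite addnC.
  have Y0 : 0 <= pow32 (3 / 2) * pow32 (fact_ratio n) * zeta32 ^+ n.
    by rewrite !mulr_ge0 ?exprn_ge0.
  have := ler_wpM2l Y0 letn; congr (_ <= _).
    by move: (tau ^+ nc) (_ ^+ r1) (zeta32 ^+ n) => ? ? ?; ring.
  by move: (tau ^+ n) (zeta32 ^+ n) => ? ?; ring.
have pow4 x : 0 <= x -> pow32 x ^+ 4 = x ^+ 6.
  by move=> x0; rewrite (exprM _ 2 2) pow32_sqr // -exprM.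
have swap (x : R) : (x ^+ n) ^+ 4 = (x ^+ 4) ^+ n by rewrite -!exprM mulnC.
(* The fourth power clears all radicals; the constants fit since (3/2)^6 10^8 <= 242^4. *)
apply: root4; [by rewrite !mulr_ge0 ?exprn_ge0 | by lra |].
have c06 : pow32 (3 / 2) ^+ 4 = (3 / 2) ^+ 6 by apply: pow4; lra.
have -> : (pow32 (3 / 2) * tau ^+ n * pow32 (fact_ratio n) * zeta32 ^+ n) ^+ 4 =
    (3 / 2) ^+ 6 * (fact_ratio n ^+ 6 * (8 * zeta32 ^+ 4) ^+ n).
  rewrite 3!exprMn [(8 * _) ^+ n]exprMn !swap tau4 c06 pow4 ?fact_ratio_ge0 //.
  move: (fact_ratio n ^+ _) (8 ^+ n) ((zeta32 ^+ _) ^+ n) ((3 / 2) ^+ 6) => a b c d; ring.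
have := growth_le n0.
have : fact_ratio n ^+ 6 * (8 * zeta32 ^+ 4) ^+ n <= growth n.
  apply: ler_wpM2l; first exact/exprn_ge0/fact_ratio_ge0.
  by apply: lerXn2r zeta32_pow4; rewrite nnegrE ?growth_base_ge0 ?mulr_ge0 ?exprn_ge0.
move: (_ * (8 * _) ^+ n) (growth n) => a b; lra.
Qed.

End Numerics.

(** * From the count of tuples to the bound on the class number *)

Lemma counting_image_le (R : realType) (T : choiceType) (U : finType)
    (D : {set U}) (g : U -> T) (A : set T) :
  A `<=` [set g u | u in [set` D]] -> (counting A <= (#|D|%:R)%:E :> \bar R)%E.
Proof.
move=> subA; have finA : finite_set A.
  by apply: sub_finite_set subA _; apply: finite_image; apply: finite_finset.
rewrite /counting asboolT // lee_fin ler_nat.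
rewrite [X in (_ <= X)%N]cardE -(size_map g (enum D)); apply: uniq_leq_size.
  exact: finmap.fset_uniq.
move=> x; rewrite in_fset_set // inE => /subA[u /= Du <-].
by apply: map_f; rewrite mem_enum.
Qed.

Lemma pow32_sqrt (R : realType) (d : R) : 0 < d ->
  pow32 (Num.sqrt d) = d `^ (3 / 4).
Proof.
move=> d0; rewrite /pow32 -!powR12_sqrt ?powR_ge0 ?ltW // -powRrM -powRD.
  by congr (_ `^ _); field.
by rewrite gt_eqF // implybT.
Qed.

Theorem lemma3p1 (R : realType) (k : fieldExtType rat) (r1 r2 : nat)
    (hsig : has_signature R k r1 r2) :
  (class_number R k <=
    (242 * (ratr (abs_disc k) `^ (3 / 4)) / (164 / 100) ^+ r1)%:E)%E.
Proof.
have [theta [s [s_inj s_all]]] := complete_embeddings R[i] k.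
have /choice[pi s_conj] : forall i, exists j, forall x, s j x = conjc (s i x).
  move=> i; have [j fj] := s_all [the {rmorphism k -> R[i]} of conjc \o s i].
  by exists j => x; rewrite -fj.
set n := \dim {:k} in s pi s_inj s_all s_conj *.
set d : R := ratr (abs_disc k).
have n0 : (0 < n)%N by rewrite /n (adim_gt0 {:k}%AS).
have d0 : 0 < d.
  have [b [fb _] discE] := abs_discE k.
  by rewrite /d discE ltr0q normr_gt0 free_disc_neq0.
(* Distinct real places come from distinct embeddings, and these are fixed by [pi]. *)
have le_r1 : (r1 + nb_complex pi <= n)%N.
  have [/card_set_bijP[f [ff injf surf]] _] := hsig.
  have ex_i (m : 'I_r1) : exists i, pi i == i /\ f (fun x => `|s i x|) = m.
    have [w [u ureal ->] fw] := surf m (ltn_ord m).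
    have [i ui] := s_all u; exists i; split; last first.
      by rewrite -fw; congr f; apply/funext => x; rewrite ui.
    apply/eqP/s_inj; rewrite /= s_conj -ui.
    by have /complex_realP[a ->] := ureal theta; rewrite conjc_real.
  have [j jP] := fin_all_exists ex_i.
  have injj : injective j.
    move=> a b eqj; apply: val_inj; have [_ fa] := jP a; have [_ fb] := jP b.
    by rewrite /= -fa eqj fb.
  rewrite -(card_ord n) -(cardC [pred i | pi i != i]) addnC leq_add2l.
  rewrite -[r1]card_ord -(card_codom injj); apply/subset_leq_card/fintype.subsetP.
  move=> i /codomP[a ->]; rewrite !inE negbK.
  by have [] := jP a.
(* The leading 3/2 is the value given to [c0] in [minkowski_ideal]. *)
pose kappa := 3 / 2 * Num.sqrt 2 ^+ nb_complex pi * fact_ratio R n * Num.sqrt d.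
have c01 : 1 < 3 / 2 :> R by lra.
pose N := Num.truncn kappa.
have kappa0 : 0 <= kappa.
  by rewrite !mulr_ge0 ?exprn_ge0 ?sqrtr_ge0 ?fact_ratio_ge0 // ltW.
have /andP[leN ltN] := truncn_itv kappa0.
have small_index I : fractional_ideal I -> exists x,
    [/\ I x, x != 0 & ~ idx_ge I (scaleI x (ring_of_integers k)) N.+1].
  move=> FI; have [x [Ix x0 bound]] := minkowski_ideal s_inj s_conj c01 FI.
  exists x; split=> // /bound; rewrite leNgt => /negP; apply.
  exact: ltN.
have [phi [phiP phi_inj]] := exists_tuple_code small_index.
pose good J := [/\ fractional_ideal J, ring_of_integers k `<=` J &
  ~ idx_ge J (ring_of_integers k) N.+1].
(* [g] decodes a tuple into an ideal class, well defined because [phi] is injective on good ideals;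
   tuples that code nothing get the default [set0]. *)
have /choice[g gP] : forall f : {ffun 'I_n -> 'I_N}, exists C, forall J, good J ->
    phi J = [ffun i => (f i).+1] -> ideal_class J = C.
  move=> f; have [[J [gJ phiJ]]|no] :=
      pselect (exists J, good J /\ phi J = [ffun i => (f i).+1]).
    exists (ideal_class J) => J' gJ' phiJ'; congr ideal_class.
    have [FJ OJ iJ] := gJ; have [FJ' OJ' iJ'] := gJ'.
    by apply: phi_inj => //; rewrite phiJ' phiJ.
  by exists set0 => J gJ phiJ; exfalso; apply: no; exists J.
pose D := [set f : {ffun 'I_n -> 'I_N} | (\prod_i (f i).+1 <= N)%N]%SET.
have le_card : (class_number R k <= (#|D|%:R)%:E)%E.
  apply: (@counting_image_le R _ _ D g) => _ [I FI <-].
  have [x [J [x0 defI FJ OJ nidx]]] := class_representative small_index FI.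
  have [phi0 idx] := phiP J FJ OJ nidx.
  have le_prod : (\prod_i phi J i <= N)%N.
    rewrite leqNgt; apply/negP => lt; apply: nidx; exact: idx_ge_le idx.
  (* Entries are positive with product at most N, so each is between 1 and N and its predecessor
     fits in ['I_N]. *)
  have ltphi i : ((phi J i).-1 < N)%N.
    rewrite prednK // (leq_trans _ le_prod) // (bigD1 i) //= leq_pmulr //.
    by rewrite prodn_gt0.
  pose f : {ffun 'I_n -> 'I_N} := [ffun i => Ordinal (ltphi i)].
  have phif : phi J = [ffun i => (f i).+1] by apply/ffunP => i; rewrite !ffunE /= prednK.
  exists f.
    rewrite /= inE; apply: leq_trans le_prod; rewrite phif.
    by under [leqRHS]eq_bigr do rewrite ffunE.
  rewrite -(gP f J) //; apply/seteqP; rewrite defI; split=> _ [a a0 ->].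
    exists (a / x); first by rewrite mulf_neq0 ?invr_eq0.
    by rewrite -/(scaleI (a / x) (scaleI x J)) scaleI_scale mulfVK.
  exists (a * x); first by rewrite mulf_neq0.
  exact: scaleI_scale.
apply: (le_trans le_card); rewrite lee_fin.
apply: le_trans (card_bounded_tuples R n N) _.
have z0 : 0 <= zeta32 R by rewrite addr_ge0 // divr_ge0 ?sqrtr_ge0.
apply: (@le_trans _ _ (pow32 kappa * zeta32 R ^+ n)).
  by rewrite ler_wpM2r ?exprn_ge0 // ler_pow32 ?ler0n.
have := final_constant R n0 le_r1.
rewrite -(ler_pM2r (powR_gt0 (3 / 4) d0)) -pow32_sqrt //.
have -> : pow32 kappa = pow32 (3 / 2) * pow32 (Num.sqrt 2) ^+ nb_complex pi *
    pow32 (fact_ratio R n) * pow32 (Num.sqrt d).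
  rewrite /kappa !pow32M ?mulr_ge0 ?exprn_ge0 ?sqrtr_ge0 ?fact_ratio_ge0 //;
    rewrite ?pow32X ?sqrtr_ge0 //; exact: ltW (lt_trans _ c01).
by rewrite [leLHS]mulrAC [X in _ <= X]mulrAC.
Qed.
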